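(* For every real number $\alpha>1$, $\Omega_\alpha(\sqrt{s})\le \frac{s}{\alpha}-d(\alpha,s)\le O_\alpha\bigl(\sqrt{s\log s}\bigr)$ as $s\to\infty$. That is, for every real $\alpha>1$ there exist constants $c_\alpha,C_\alpha>0$ and $s_0(\alpha)$, depending only on $\alpha$, such that for every integer $s\ge s_0(\alpha)$, $$c_\alpha\sqrt{s}\le \frac{s}{\alpha}-d(\alpha,s)\le C_\alpha\sqrt{s\log s}.$$
   Context: Digraphs are finite, without loops and without parallel arcs in the same direction (pairs of opposite arcs are allowed). The minimum out-degree of a digraph is the minimum over its vertices of the number of out-neighbours. For a real number $\alpha>1$ and a positive integer $s$, $d(\alpha,s)$ denotes the largest integer $d$ such that, for every positive integer $n$, every digraph on $\lfloor\alpha n\rfloor$ vertices with minimum out-degree at least $s$ contains a subdigraph on $n$ vertices with minimum out-degree at least $d$. *)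

(* Defs.v *)
From HB Require Import structures.
From mathcomp Require Import all_boot all_order all_algebra.
From mathcomp Require Import boolp classical_sets reals.

Set Implicit Arguments.
Unset Strict Implicit.
Unset Printing Implicit Defensive.

Import Order.TTheory GRing.Theory Num.Theory.

Local Open Scope ring_scope.

(* The vertex set is a subset of an ambient finite type, so that a digraph and
   its subdigraphs are objects of the same type. *)
Record digraph (V : finType) := Digraph {
  vertices : {set V};
  arc : rel V;
  arc_vertices : forall x y, arc x y -> (x \in vertices) && (y \in vertices);
  arc_irrefl : irreflexive arc
}.

Definition outdeg (V : finType) (G : digraph V) (x : V) : nat :=
  #|[set y | arc G x y]|.

(* Every out-degree is smaller than the number of vertices, so the default
   value #|vertices G| only matters for the digraph without vertices. *)
Definition min_outdeg (V : finType) (G : digraph V) : nat :=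
  \big[minn/#|vertices G|]_(x in vertices G) outdeg G x.

Definition subdigraph (V : finType) (H G : digraph V) : Prop :=
  vertices H \subset vertices G /\ (forall x y, arc H x y -> arc G x y).

Definition guaranteed (R : realType) (alpha : R) (s d : nat) : Prop :=
  forall n : nat, (0 < n)%N ->
  forall (V : finType) (G : digraph V),
    #|vertices G|%:Z = Num.floor (alpha * n%:R) ->
    (s <= min_outdeg G)%N ->
    exists H : digraph V,
      [/\ subdigraph H G, #|vertices H| = n & (d <= min_outdeg H)%N].

Definition is_largest (P : nat -> Prop) (d : nat) : Prop :=
  P d /\ (forall d', P d' -> (d' <= d)%N).

(* The default value 0 is never used when 1 < alpha: see dmaxP. The largest
   natural number is also the largest integer, since 0 is guaranteed. *)
Definition dmax (R : realType) (alpha : R) (s : nat) : nat :=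
  xget 0%N [set d | is_largest (guaranteed alpha s) d].

Lemma min_outdeg_leP (V : finType) (G : digraph V) (s : nat) :
  (s <= #|vertices G|)%N ->
  (forall x, x \in vertices G -> (s <= outdeg G x)%N) ->
  (s <= min_outdeg G)%N.
Proof.
move=> s0 sG; rewrite /min_outdeg; elim/big_ind: _ => // a b sa sb.
by rewrite leq_min sa.
Qed.

Lemma min_outdeg_lt (V : finType) (G : digraph V) :
  (0 < #|vertices G|)%N -> (min_outdeg G < #|vertices G|)%N.
Proof.
case/card_gt0P => x xG; rewrite /min_outdeg -minEnat.
apply: (leq_ltn_trans (bigmin_le_cond _ (outdeg G) xG)); apply: proper_card.
apply/properP; split.
  by apply/fintype.subsetP => y; rewrite inE => /arc_vertices/andP[].
by exists x => //; rewrite inE arc_irrefl.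
Qed.

Lemma floor_ge_n (R : realType) (alpha : R) (n : nat) :
  1 < alpha -> n%:Z <= Num.floor (alpha * n%:R).
Proof.
by move=> a1; rewrite floor_ge_int -pmulrn ler_peMl // ltW.
Qed.

Lemma guaranteed0 (R : realType) (alpha : R) (s : nat) :
  1 < alpha -> guaranteed alpha s 0.
Proof.
move=> a1 n n0 V G GE _.
have : (n <= #|vertices G|)%N by rewrite -lez_nat GE floor_ge_n.
case/card_geqP => t [ut st tG].
have sub0 x y : false -> (x \in [set x in t]) && (y \in [set x in t]) by [].
exists (@Digraph V [set x in t] (fun _ _ => false) sub0 (fun=> erefl)).
split=> //=.
  by split => //=; apply/fintype.subsetP => x; rewrite inE => /tG.
by rewrite cardsE (card_uniqP ut).
Qed.

Lemma guaranteed_le (R : realType) (alpha : R) (s d : nat) :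
  1 < alpha -> guaranteed alpha s d -> (d <= s)%N.
Proof.
move=> a1 /(_ s.+1 isT).
have := floor_ge_n s.+1 a1; case E: Num.floor => [m|//] sm.
rewrite lez_nat in sm.
have cv (x y : 'I_m) : x != y ->
    (x \in [set: 'I_m]) && (y \in [set: 'I_m]) by rewrite !inE.
have ci : irreflexive (fun x y : 'I_m => x != y) by move=> x; rewrite eqxx.
move=> /(_ 'I_m (Digraph cv ci)) /=; rewrite cardsT card_ord => /(_ erefl).
case=> [|H [_ Hs dH]].
  apply: min_outdeg_leP => [|x _]; first by rewrite /= cardsT card_ord ltnW.
  rewrite /outdeg /=.
  have -> : [set y | x != y] = [set~ x]%SET.
    by apply/setP => y; rewrite !inE eq_sym.
  by rewrite cardsC1 card_ord; case: m sm {E cv ci x}.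
by rewrite -ltnS -Hs (leq_ltn_trans dH) // min_outdeg_lt // Hs.
Qed.

Lemma dmaxP (R : realType) (alpha : R) (s : nat) :
  1 < alpha -> is_largest (guaranteed alpha s) (dmax alpha s).
Proof.
move=> a1; rewrite /dmax; case: xgetP => // /(_ _) no; exfalso.
have ex : exists d, `[< guaranteed alpha s d >].
  by exists 0%N; apply/asboolP/guaranteed0.
have ub d : `[< guaranteed alpha s d >] -> (d <= s)%N.
  by move=> /asboolP; apply: guaranteed_le.
case: (ex_maxnP ex ub) => d /asboolP gd dub.
by apply: (no d); split => // d' gd'; apply/dub/asboolP.
Qed.

(* Main.v *)
Require Import Defs.
From mathcomp Require Import all_boot all_order all_algebra.
From mathcomp Require Import reals sequences exp.
From mathcomp Require Import ring lra zify.

Set Implicit Arguments.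
Unset Strict Implicit.
Unset Printing Implicit Defensive.

Import Order.TTheory GRing.Theory Num.Theory.

Local Open Scope ring_scope.

(** The two inequalities are independent.

    UPPER BOUND on the gap.  Keep from every vertex exactly [s] out-neighbours
    and call a vertex popular when at least [s ^ 2] vertices keep it.  At most
    a fraction [1 / s] of the vertices are popular, so all of them can be put
    into the wanted set.  Every other vertex is put into it independently with
    a probability [p] slightly below [1 / alpha].  That some vertex sees fewer
    than [p * s - t] chosen out-neighbours, or that some block of at most [s]
    vertices contains more chosen vertices than expected plus [t], has
    probability at most [s ^ -4] for [t] of order [sqrt (s * ln s)]
    ([bernoulli_tail]); and since popular vertices are not random, each of
    these events depends on at most [s ^ 3] others.  The local lemma
    ([local_lemma]) avoids all of them.  The block events bound the number of
    chosen vertices by [n] although the digraph may be arbitrarily large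
    compared with [s], and since all vertices, chosen or not, see many chosen
    ones, the set may be enlarged arbitrarily to size [n]
    ([guaranteed_of_tail]).

    LOWER BOUND on the gap.  The extremal digraph is a random regular
    multipartite tournament with [r] parts of [2 * h] vertices, [r] being
    between [2 * h] and [4 * h].  Being a multipartite tournament, any vertex
    set [S] of size [N] spans at most [N ^ 2 * (1 - 1 / r) / 2] arcs, so a set
    in which all degrees exceed the average minus [c * h] must meet all parts
    almost equally and must have almost all its degrees within a small multiple
    of [h] of the average ([sum_abs_deviation], [few_not_flat]).  Exact
    regularity is obtained by splitting each part into pairs, every outside
    vertex pointing to exactly one vertex of each pair; which one is random.
    The crucial point is that the pairing of a part that a vertex uses depends
    on the part of that vertex, and that these pairings run through a
    1-factorization of a complete bipartite graph.  A set that meets the parts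
    in the right proportion is therefore cut by most of the pairings
    ([cut_slots_lower]); each cut pair contributes a random unit to a degree,
    and such a degree lies in a given window of length [gamma * h] with
    probability [O(gamma)] ([card_window]).  The rows of the random matrix are
    independent, so for [gamma] small the probability that a positive fraction
    of the rows are all concentrated beats the [2 ^ (2 * r * h)] choices of [S]
    ([exists_avoiding_matrix]).  Finally each [s] is within [O(s ^ (1 / 4))] of
    a possible degree [(r - 1) * h], because of the identity
    [(m - j) * (m + j) = m ^ 2 - j ^ 2] ([near_square_product]), and a bounded
    number of vertices without in-neighbours adjusts the number of vertices to
    the required integer part ([guaranteed_regular]). *)

(** * The symmetric local lemma on a finite weighted space *)

Definition prob (R : realFieldType) (Om : finType) (w : Om -> R) (A : pred Om) : R :=
  \sum_(o | A o) w o.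

Definition avoids (Om I : finType) (A : I -> pred Om) (J : {set I}) : pred Om :=
  fun o => [forall j in J, ~~ A j o].

Lemma prob_ge0 (R : realFieldType) (Om : finType) (w : Om -> R) (A : pred Om) :
  (forall o, 0 <= w o) -> 0 <= prob w A.
Proof. by move=> w0; apply: sumr_ge0. Qed.

Lemma prob_sub (R : realFieldType) (Om : finType) (w : Om -> R) (A B : pred Om) :
  (forall o, 0 <= w o) -> subpred A B -> prob w A <= prob w B.
Proof.
move=> w0 AB; rewrite /prob (bigID A B) /=.
rewrite (eq_bigl A); last by move=> o; case: (boolP (A o)) => [/AB ->|]; rewrite ?andbF.
by rewrite lerDl sumr_ge0.
Qed.

Lemma prob_split (R : realFieldType) (Om : finType) (w : Om -> R) (A B : pred Om) :
  prob w B = prob w (predI A B) + prob w (predI (predC A) B).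
Proof.
rewrite /prob (bigID A B) /=.
by congr (_ + _); apply: eq_bigl => o /=; rewrite andbC.
Qed.

Lemma avoidsU1 (Om I : finType) (A : I -> pred Om) (J : {set I}) (i : I) (o : Om) :
  avoids A (i |: J) o = ~~ A i o && avoids A J o.
Proof.
apply/forall_inP/andP => [h|[h1 /forall_inP h2] j].
  split; first by apply: h; rewrite setU11.
  by apply/forall_inP => j jJ; apply: h; rewrite setU1r.
by rewrite in_setU1 => /orP[/eqP->|/h2].
Qed.

Lemma prob_avoids_step (R : realFieldType) (Om I : finType) (w : Om -> R)
    (A : I -> pred Om) (J : {set I}) (i : I) :
  prob w (avoids A (i |: J)) =
  prob w (avoids A J) - prob w (predI (A i) (avoids A J)).
Proof.
rewrite (prob_split w (A i) (avoids A J)) addrC addKr.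
by apply: eq_bigl => o; rewrite avoidsU1.
Qed.

(** The union bound, relative to the event that the events of [J] are
    avoided. *)
Lemma prob_avoids_diff (R : realFieldType) (Om I : finType) (w : Om -> R)
    (A : I -> pred Om) (J K : {set I}) (q : R) :
  (forall o, 0 <= w o) -> 0 <= q ->
  (forall i, i \in K -> prob w (predI (A i) (avoids A J)) <= q * prob w (avoids A J)) ->
  prob w (avoids A J) - (#|K|%:R * q) * prob w (avoids A J) <= prob w (avoids A (K :|: J)).
Proof.
move=> w0 q0; elim: {K}_.+1 {-2}K (ltnSn #|K|) => // n IH K.
have [->|[i iK]] := set_0Vmem K; first by rewrite cards0 set0U => _ _; rewrite !mul0r subr0.
rewrite (cardsD1 i) iK ltnS add1n => cK hK.
have sub j : j \in K :\ i -> prob w (predI (A j) (avoids A J)) <= q * prob w (avoids A J).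
  by rewrite !inE => /andP[_ /hK].
have {}IH := IH (K :\ i) cK sub.
rewrite -(setD1K iK) -setUA prob_avoids_step setD1K //.
have : prob w (predI (A i) (avoids A (K :\ i :|: J))) <= q * prob w (avoids A J).
  apply: le_trans (hK i iK); apply: prob_sub => // o /andP[/= -> /forall_inP h] /=.
  by apply/forall_inP => j jJ; apply: h; rewrite inE jJ orbT.
rewrite -natr1 in IH *.
by move: IH; set a := prob w (avoids A (_ :|: _)); set b := prob w _; set c := prob w _; lra.
Qed.

(** The usual conditional induction, written without quotients: given that
    the events of [J] are avoided, event [i] has probability at most [2 * p].
    Those of [J] on which [i] depends number at most [D], so by induction they
    remove at most half of the probability of avoiding the others, and this
    factor 2 is the one that is lost.  Independence enters as an
    upper bound on the joint probability of [A i] and the avoidance of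
    non-neighbours. *)
Lemma local_lemma (R : realFieldType) (Om I : finType) (w : Om -> R)
    (A : I -> pred Om) (dep : rel I) (p : R) (D : nat) :
  (forall o, 0 <= w o) -> 0 < prob w predT -> 0 <= p -> p < 2^-1 ->
  4 * p * D%:R <= 1 ->
  (forall i, (#|[set j | dep i j]| <= D)%N) ->
  (forall i (J : {set I}), (forall j, j \in J -> ~~ dep i j) ->
     prob w (predI (A i) (avoids A J)) <= p * prob w (avoids A J)) ->
  exists o, forall i, ~~ A i o.
Proof.
move=> w0 wT p0 p2 pD hD indep.
have step (J : {set I}) i :
    prob w (predI (A i) (avoids A J)) <= 2 * p * prob w (avoids A J).
  elim: {J}_.+1 {-2}J (ltnSn #|J|) i => // n IH J; rewrite ltnS => cJ i.
  pose J1 := J :&: [set j | dep i j]; pose J2 := J :\: [set j | dep i j].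
  have JE : J = J1 :|: J2 by rewrite setID.
  (* Independence applies once the neighbours of [i] are dropped from [J]. *)
  have h2 : prob w (predI (A i) (avoids A J)) <= p * prob w (avoids A J2).
    apply: le_trans (indep i J2 _); last by move=> j; rewrite !inE => /andP[].
    apply: prob_sub => // o /andP[/= -> /forall_inP h] /=.
    by apply/forall_inP => j; rewrite inE => /andP[_ /h].
  have c1 : (#|J1| <= D)%N.
    by apply: leq_trans (hD i); apply: subset_leq_card; apply: subsetIr.
  have [J10|J1n] := eqVneq J1 set0.
    rewrite J10 set0U in JE; rewrite -JE in h2.
    apply: le_trans h2 _; rewrite ler_wpM2r ?prob_ge0 //; lra.
  have lt2 : (#|J2| < n)%N.
    apply: leq_trans cJ; rewrite [in X in (_ < X)%N]JE cardsU.
    have -> : J1 :&: J2 = set0.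
      by apply/setP => j; rewrite !inE; case: (dep i j); rewrite ?andbF.
    by rewrite cards0 subn0 -[X in (X < _)%N]add0n ltn_add2r card_gt0.
  have := @prob_avoids_diff R Om I w A J2 J1 (2 * p) w0 _ (fun j _ => IH J2 lt2 j).
  have q0 : 0 <= 2 * p by lra.
  rewrite -JE => /(_ q0) h3.
  have h4 : #|J1|%:R * (2 * p) <= 2^-1.
    have : #|J1|%:R * (2 * p) <= D%:R * (2 * p).
      by rewrite ler_wpM2r ?ler_nat //; lra.
    by move=> /le_trans; apply; nra.
  have P2 : 0 <= prob w (avoids A J2) by apply: prob_ge0.
  have : 2^-1 * prob w (avoids A J2) <= prob w (avoids A J).
    by apply: le_trans h3; move: P2 h4; nra.
  by move: h2 p0; nra.
have pos (J : {set I}) : 0 < prob w (avoids A J).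
  elim: {J}_.+1 {-2}J (ltnSn #|J|) => // n IH J; rewrite ltnS => cJ.
  have [->|[i iJ]] := set_0Vmem J.
    rewrite (_ : prob w _ = prob w predT) //; apply: eq_bigl => o.
    by apply/forall_inP => j; rewrite inE.
  rewrite -(setD1K iJ) prob_avoids_step subr_gt0.
  have /IH h : (#|J :\ i| < n)%N by move: cJ; rewrite (cardsD1 i) iJ.
  apply: le_lt_trans (step _ _) _; rewrite gtr_pMl //; lra.
have := pos setT; rewrite /prob; case: (pickP (avoids A [set: I])) => [o /forall_inP h _|no].
  by exists o => i; apply: h; rewrite inE.
by rewrite big_pred0 ?ltxx.
Qed.

(** * Independent coin tosses *)

Definition coin (R : realFieldType) (p : R) (b : bool) : R := if b then p else 1 - p.

Definition bernoulli (R : realFieldType) (V : finType) (p : R) (f : {ffun V -> bool}) : R :=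
  \prod_y coin p (f y).

Lemma coin_ge0 (R : realFieldType) (p : R) (b : bool) : 0 <= p <= 1 -> 0 <= coin p b.
Proof. by case: b => /=; rewrite /coin => /andP[]; lra. Qed.

Lemma bernoulli_ge0 (R : realFieldType) (V : finType) (p : R) (f : {ffun V -> bool}) :
  0 <= p <= 1 -> 0 <= bernoulli p f.
Proof. by move=> p01; apply: prodr_ge0 => y _; apply: coin_ge0. Qed.

(** Fubini for the product measure: the expectation of a product of functions
    of one coordinate each. *)
Lemma sum_bernoulli (R : realFieldType) (V : finType) (p : R) (F : V -> bool -> R) :
  \sum_(f : {ffun V -> bool}) bernoulli p f * \prod_y F y (f y) =
  \prod_y (p * F y true + (1 - p) * F y false).
Proof.
transitivity (\prod_(y : V) \sum_(b : bool) coin p b * F y b).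
  rewrite bigA_distr_bigA /=; apply: eq_bigr => f _.
  by rewrite -big_split.
by apply: eq_bigr => y _; rewrite big_bool.
Qed.

Lemma prob_bernoulliT (R : realFieldType) (V : finType) (p : R) :
  prob (@bernoulli R V p) predT = 1.
Proof.
rewrite -[RHS](@big1_eq R 1 *%R V (index_enum V) xpredT) /prob.
transitivity (\sum_(f : {ffun V -> bool}) bernoulli p f * \prod_(y : V) (fun _ _ => 1) y (f y)).
  by apply: eq_bigr => f _; rewrite big1_eq mulr1.
by rewrite (sum_bernoulli p (fun _ _ => 1)); apply: eq_bigr => y _; rewrite !mulr1 addrC subrK.
Qed.

Definition determined_on (V : finType) (T : {set V}) (A : pred {ffun V -> bool}) : Prop :=
  forall f g : {ffun V -> bool}, {in T, f =1 g} -> A f = A g.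

Definition splice (V : finType) (T : {set V}) (f g : {ffun V -> bool}) : {ffun V -> bool} :=
  [ffun y => if y \in T then f y else g y].

(** Events on disjoint sets of coordinates are independent because swapping
    the coordinates in [T] between two independent samples preserves the
    product measure, and turns [A f] and [B g] into statements about a single
    sample. *)
Lemma bernoulli_indep (R : realFieldType) (V : finType) (p : R) (T : {set V})
    (A B : pred {ffun V -> bool}) :
  determined_on T A -> determined_on (~: T) B ->
  prob (@bernoulli R V p) (predI A B) =
  prob (@bernoulli R V p) A * prob (@bernoulli R V p) B.
Proof.
move=> hA hB; rewrite -[LHS]mulr1 -[X in _ * X = _](prob_bernoulliT V p).
rewrite /prob !big_distrlr /= !pair_big_dep /=.
pose swap (fg : {ffun V -> bool} * {ffun V -> bool}) :=
  (splice T fg.1 fg.2, splice T fg.2 fg.1).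
have swapK : involutive swap.
  have spliceK (f g : {ffun V -> bool}) : splice T (splice T f g) (splice T g f) = f.
    by apply/ffunP => y; rewrite !ffunE; case: (y \in T).
  by move=> [f g]; rewrite /swap /= !spliceK.
rewrite (reindex_inj (inv_inj swapK)) /=; apply: eq_big => [[f g]|[f g] _] /=.
  rewrite !andbT; congr (_ && _); first by apply: hA => y yT; rewrite ffunE yT.
  by apply: hB => y; rewrite inE => /negbTE yT; rewrite ffunE yT.
rewrite /bernoulli -!big_split; apply: eq_bigr => y _ /=; rewrite !ffunE.
by case: ifP => // _; rewrite mulrC.
Qed.

(** Follows from [1 + x <= expR x] by inverting, as
    [(1 + x) * (1 - x + x ^ 2) = 1 + x ^ 3]. *)
Lemma expR_le_quadratic (R : realType) (x : R) : 0 <= x -> expR (- x) <= 1 - x + x ^+ 2.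
Proof.
move=> x0; rewrite expRN; have e0 := expR_gt0 x; have := expR_ge1Dx x => e1.
rewrite -[X in X <= _]mul1r ler_pdivrMr //.
have : 0 <= 1 - x + x ^+ 2 by nra.
nra.
Qed.

(** Chernoff's method with parameter [l = t / (2 * s)].  Both outcomes [b] of a
    toss are covered, so the same bound serves for too few and for too many
    successes. *)
Lemma bernoulli_tail (R : realType) (V : finType) (p : R) (F : {set V}) (b : bool)
    (s : nat) (t : R) :
  0 <= p <= 1 -> 0 <= t -> (0 < s)%N -> (#|F| <= s)%N ->
  prob (@bernoulli R V p)
    (fun f => #|[set y in F | f y == b]|%:R < coin p b * #|F|%:R - t)
  <= expR (- (t ^+ 2 / (4 * s%:R))).
Proof.
move=> p01 t0 s0 Fs; set c := coin p b.
have c0 : 0 <= c by apply: coin_ge0.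
have c1 : c <= 1 by move: p01; rewrite /c /coin => /andP[]; case: (b); lra.
have sR : 0 < s%:R :> R by rewrite ltr0n.
pose l := t / (2 * s%:R).
have l0 : 0 <= l by rewrite divr_ge0 // mulr_ge0 // ltW.
pose w (y : V) (a : bool) : R := if y \in F then (if a == b then expR (- l) else 1) else 1.
have wE (f : {ffun V -> bool}) :
    \prod_y w y (f y) = expR (- (l * #|[set y in F | f y == b]|%:R)).
  transitivity (\prod_(y in [set y in F | f y == b]) expR (- l)).
    rewrite [RHS]big_mkcond /=; apply: eq_bigr => y _; rewrite inE /w.
    by case: (y \in F) => //=.
  by rewrite prodr_const -expRM_natr mulNr.
have mgf : \sum_(f : {ffun V -> bool}) bernoulli p f * \prod_y w y (f y)
    <= expR (#|F|%:R * (c * (- l + l ^+ 2))).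
  rewrite sum_bernoulli.
  rewrite mulrC expRM_natr -prodr_const [X in _ <= X]big_mkcond /=.
  apply: ler_prod => y _; rewrite /w; case: (y \in F); last by lra.
  have e0 := expR_gt0 (- l); have e1 := expR_le_quadratic l0.
  have e2 := expR_ge1Dx (c * (- l + l ^+ 2)).
  have -> : p * (if true == b then expR (- l) else 1) +
      (1 - p) * (if false == b then expR (- l) else 1) = 1 - c + c * expR (- l).
    by rewrite /c /coin; case: (b) => /=; ring.
  by apply/andP; split; nra.
(* Markov's inequality for the exponential moment. *)
have markov : prob (@bernoulli R V p)
      (fun f => #|[set y in F | f y == b]|%:R < c * #|F|%:R - t) <=
    expR (l * (c * #|F|%:R - t)) *
      \sum_(f : {ffun V -> bool}) bernoulli p f * \prod_y w y (f y).
  rewrite mulr_sumr /prob big_mkcond /=; apply: ler_sum => f _.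
  have b0 := bernoulli_ge0 f p01.
  have e0 := expR_gt0 (l * (c * #|F|%:R - t)).
  case: ifP => h; last by rewrite wE mulr_ge0 ?mulr_ge0 ?expR_ge0.
  rewrite wE mulrCA -expRD -[X in X <= _]mulr1 ler_wpM2l //.
  rewrite -[X in X <= _]expR0 ler_expR.
  by rewrite -mulrBr mulr_ge0 // subr_ge0 ltW.
apply: le_trans markov _.
apply: le_trans (ler_wpM2l (expR_ge0 _) mgf) _.
rewrite -expRD ler_expR.
have Fs' : #|F|%:R <= s%:R :> R by rewrite ler_nat.
have -> : l * (c * #|F|%:R - t) + #|F|%:R * (c * (- l + l ^+ 2)) =
   - (l * t) + (c * #|F|%:R) * l ^+ 2 by ring.
have h : c * #|F|%:R <= s%:R.
  by apply: le_trans Fs'; rewrite ler_piMl.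
apply: (@le_trans _ _ (- (l * t) + s%:R * l ^+ 2)).
  by rewrite lerD2l ler_wpM2r ?sqr_ge0.
rewrite /l le_eqVlt; apply/orP; left; apply/eqP.
by field; rewrite pnatr_eq0 -lt0n.
Qed.

(** * A small set seen often by every vertex *)

Lemma determined_avoids (V I : finType) (A : I -> pred {ffun V -> bool})
    (F : I -> {set V}) (T : {set V}) (J : {set I}) :
  (forall i, determined_on (F i) (A i)) ->
  (forall j, j \in J -> [disjoint T & F j]) ->
  determined_on (~: T) (avoids A J).
Proof.
move=> hA dis f g fg; rewrite /avoids; apply: eq_forallb_in => j jJ.
congr (~~ _); apply: hA => y yF; apply: fg; rewrite inE.
by apply: contraL (dis j jJ) => yT; apply/pred0Pn; exists y; rewrite /= yT.
Qed.

Lemma leq_card_bigcup (I T : finType) (P : pred I) (F : I -> {set T}) :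
  (#|\bigcup_(i | P i) F i| <= \sum_(i | P i) #|F i|)%N.
Proof.
elim/big_rec2: _ => [|i n A _ h]; first by rewrite cards0.
by rewrite (leq_trans (leq_card_setU _ _)) // leq_add2l.
Qed.

(** All the deviations can be avoided at once when each coordinate lies in at
    most [D] of the sets [F i]: an event then shares coordinates with at most
    [s * D] others. *)
Lemma bernoulli_local_lemma (R : realType) (V I : finType) (p : R)
    (F : I -> {set V}) (b : I -> bool) (s D : nat) (t : R) :
  0 <= p <= 1 -> 0 <= t -> (0 < s)%N -> (forall i, (#|F i| <= s)%N) ->
  (forall y, (#|[set i | y \in F i]| <= D)%N) ->
  expR (- (t ^+ 2 / (4 * s%:R))) < 2^-1 ->
  4 * expR (- (t ^+ 2 / (4 * s%:R))) * (s * D)%:R <= 1 ->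
  exists f : {ffun V -> bool}, forall i,
    coin p (b i) * #|F i|%:R - t <= #|[set y in F i | f y == b i]|%:R.
Proof.
move=> p01 t0 s0 Fs hD q2 qD; set q := expR _ in q2 qD.
pose A i : pred {ffun V -> bool} :=
  fun f => #|[set y in F i | f y == b i]|%:R < coin p (b i) * #|F i|%:R - t.
have detA i : determined_on (F i) (A i).
  move=> f g fg; rewrite /A; congr (_%:R < _); apply: eq_card => y; rewrite !inE.
  by case: (boolP (y \in F i)) => // /fg ->.
pose dep i j := ~~ [disjoint F i & F j].
have [|||||f hf] := @local_lemma R _ I (@bernoulli R V p) A dep q (s * D) _ _ _ q2 qD; last 1 first.
- by exists f => i; rewrite leNgt; apply: hf.
- by move=> f; apply: bernoulli_ge0.
- by rewrite prob_bernoulliT ltr01.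
- exact: expR_ge0.
- move=> i; apply: leq_trans (_ : (\sum_(y in F i) #|[set j | y \in F j]| <= _)%N).
    apply: leq_trans (_ : (#|\bigcup_(y in F i) [set j | y \in F j]| <= _)%N).
      apply: subset_leq_card; apply/subsetP => j; rewrite inE => /pred0Pn[y /andP[yi yj]].
      by apply/bigcupP; exists y => //; rewrite inE.
    exact: leq_card_bigcup.
  apply: leq_trans (_ : (\sum_(y in F i) D <= _)%N); first by apply: leq_sum.
  by rewrite sum_nat_const leq_mul2r Fs orbT.
move=> i J dJ; rewrite (bernoulli_indep p (detA i)).
  rewrite ler_wpM2r //; first by apply: prob_ge0 => f; apply: bernoulli_ge0.
  exact: bernoulli_tail.
by apply: determined_avoids detA _ => j /dJ; rewrite negbK.
Qed.

Lemma sum_card_mem (A B : finType) (N : A -> {set B}) :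
  (\sum_(y : B) #|[set x | y \in N x]| = \sum_(x : A) #|N x|)%N.
Proof.
under eq_bigr => y _ do rewrite cardsE -sum1_card.
under [RHS]eq_bigr => x _ do rewrite -sum1_card.
rewrite (exchange_big_dep xpredT) //=.
Qed.

(** Cutting an enumeration into consecutive runs of length [s]. *)
Lemma card_block (V : finType) (s k : nat) : (0 < s)%N ->
  (#|[set y : V | (enum_rank y %/ s == k)%N]| <= s)%N.
Proof.
move=> s0; pose g (y : V) := Ordinal (ltn_pmod (enum_rank y) s0).
rewrite -[X in (_ <= X)%N]card_ord -(card_in_imset (f := g)) ?max_card //.
move=> x y; rewrite !inE => /eqP xk /eqP yk [] xy.
apply: enum_rank_inj; apply: val_inj => /=.
by rewrite (divn_eq (enum_rank x) s) (divn_eq (enum_rank y) s) xk yk xy.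
Qed.

(** The random part of the upper bound on the gap.  Popular vertices, those in
    at least [s ^ 2] of the sets [N x], would make too many events dependent;
    they are few and are all taken.  The blocks serve to bound the size of the
    set: the local lemma controls no quantity that depends on all coordinates,
    but a bound in each block of size [s] adds up. *)
Lemma sparse_hitting_set (R : realType) (V : finType) (N : V -> {set V}) (s : nat) (a t : R) :
  (1 < s)%N -> (s <= #|V|)%N -> (forall x, #|N x| = s) -> 0 <= t -> a <= 1 ->
  0 <= a - s%:R^-1 - 2 * t / s%:R ->
  expR (- (t ^+ 2 / (4 * s%:R))) < 2^-1 ->
  4 * expR (- (t ^+ 2 / (4 * s%:R))) * (s ^ 3)%:R <= 1 ->
  exists S : {set V}, #|S|%:R <= a * #|V|%:R /\
    forall x, a * s%:R - 1 - 3 * t <= #|N x :&: S|%:R.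
Proof.
move=> s1 sV Ns t0 a1 p0 q2 q3; have s0 : (0 < s)%N by apply: ltnW.
have sR : 0 < s%:R :> R by rewrite ltr0n.
set p := a - _ - _ in p0.
have p1 : p <= 1.
  have : 0 <= s%:R^-1 :> R by rewrite invr_ge0 ltW.
  have : 0 <= 2 * t / s%:R by rewrite divr_ge0 ?mulr_ge0 // ltW.
  by rewrite /p; lra.
set m := #|V| in sV *.
pose H := [set y | s ^ 2 <= #|[set x | y \in N x]|]%N.
have Hs : (#|H| * s <= m)%N.
  rewrite -(leq_pmul2r s0) -mulnA mulnn.
  apply: leq_trans (_ : (\sum_(y : V) #|[set x | y \in N x]| <= _)%N); last first.
    by rewrite sum_card_mem (eq_bigr _ (fun x _ => Ns x)) sum_nat_const.
  rewrite -sum_nat_const big_mkcond /=; apply: leq_sum => y _.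
  by rewrite inE; case: ifP.
(* One event for each vertex and one for each block. *)
pose I := (V + 'I_(m %/ s).+1)%type.
pose F (i : I) := match i with
  | inl x => N x :\: H
  | inr k => [set y | (enum_rank y %/ s == k)%N] :\: H
  end.
pose b (i : I) := if i is inl _ then true else false.
have [|i|y||f hf] := @bernoulli_local_lemma R V I p F b s (s ^ 2) t _ t0 s0 _ _ q2.
- by rewrite p0.
- case: i => [x|k]; apply: leq_trans (subset_leq_card (subsetDl _ _)) _.
    by rewrite Ns.
  exact: card_block.
- have [yH|yH] := boolP (y \in H).
    rewrite (_ : [set i | _] = set0) ?cards0 //; apply/setP => -[x|k]; rewrite !inE;
    by move: yH; rewrite inE => ->.
  have kP : (enum_rank y %/ s < (m %/ s).+1)%N.
    by rewrite ltnS leq_div2r // ltnW.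
  apply: leq_trans (_ : (#|inr (Ordinal kP) |: (@inl V 'I_(m %/ s).+1) @: [set x | y \in N x]| <= _)%N).
    apply: subset_leq_card; apply/subsetP => -[x|k]; rewrite !inE /=.
      move=> /andP[_ yN]; apply/imsetP; exists x => //.
      by rewrite inE.
    move=> /andP[_ /eqP yk]; apply/orP; left; apply/eqP; congr inr.
    by apply: val_inj => /=; rewrite yk.
  apply: leq_trans (leq_card_setU _ _).1 _; rewrite cards1 add1n.
  apply: leq_ltn_trans (leq_imset_card _ _) _.
  by move: yH; rewrite inE -ltnNge.
- by rewrite -expnS.
exists (H :|: [set y | f y]); split; last first.
  move=> x; have := hf (inl x) => /=; rewrite /coin => h.
  have c1 : (#|N x :&: H| + #|N x :\: H| = s)%N by rewrite cardsID Ns.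
  have c2 : (#|N x :&: H| + #|[set y in N x :\: H | f y == true]|
      <= #|N x :&: (H :|: [set y | f y])|)%N.
    rewrite -(cardsID H (N x :&: (H :|: [set y | f y]))); apply: leq_add; apply: subset_leq_card.
      by apply/subsetP => y; rewrite !inE => /andP[-> ->].
    by apply/subsetP => y; rewrite !inE eqb_id => /andP[/andP[-> ->] ->]; rewrite orbT.
  have c1R : #|N x :&: H|%:R + #|N x :\: H|%:R = s%:R :> R by rewrite -natrD c1.
  have c2R : #|N x :&: H|%:R + #|[set y in N x :\: H | f y == true]|%:R
      <= #|N x :&: (H :|: [set y | f y])|%:R :> R by rewrite -natrD ler_nat.
  have c0 : 0 <= #|N x :&: H|%:R :> R by [].
  have ps : p * s%:R = a * s%:R - 1 - 2 * t by rewrite /p; field; rewrite gt_eqF.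
  have : p * s%:R - t <= #|N x :&: (H :|: [set y | f y])|%:R.
    apply: le_trans c2R; rewrite -c1R.
    apply: le_trans (_ : #|N x :&: H|%:R + (p * #|N x :\: H|%:R - t) <= _).
      by move: c0 p1; nra.
    by rewrite lerD2l.
  by rewrite ps; lra.
have Sblocks : (#|[set y | f y] :\: H| <=
    \sum_(k < (m %/ s).+1) #|[set y in F (inr k) | f y]|)%N.
  apply: leq_trans (_ : (#|\bigcup_(k < (m %/ s).+1) [set y in F (inr k) | f y]| <= _)%N);
    last exact: leq_card_bigcup.
  apply: subset_leq_card; apply/subsetP => y; rewrite !inE => /andP[yH fy].
  have kP : (enum_rank y %/ s < (m %/ s).+1)%N.
    by rewrite ltnS leq_div2r // ltnW.
  by apply/bigcupP; exists (Ordinal kP) => //; rewrite !inE eqxx yH fy.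
have Fblocks : (\sum_(k < (m %/ s).+1) #|F (inr k)| <= m)%N.
  rewrite -(sum_card_mem (fun k => F (inr k))) /m -[X in (_ <= X)%N]sum1_card.
  apply: leq_sum => y _.
  have kP : (enum_rank y %/ s < (m %/ s).+1)%N.
    by rewrite ltnS leq_div2r // ltnW.
  rewrite -(cards1 (Ordinal kP)); apply: subset_leq_card; apply/subsetP => k.
  rewrite !inE => /andP[_ /eqP yk]; apply/eqP/val_inj; exact: esym.
have each k : #|[set y in F (inr k) | f y]|%:R <= p * #|F (inr k)|%:R + t.
  have := hf (inr k); rewrite [b _]/= [coin _ _]/=.
  have : (#|[set y in F (inr k) | f y]| + #|[set y in F (inr k) | f y == false]| = #|F (inr k)|)%N.
    rewrite -(cardsID [set y | f y] (F (inr k))); congr (_ + _)%N; apply: eq_card => y.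
      by rewrite !inE.
    by rewrite [RHS]inE !(inE, in_set) /= andbC eqbF_neg; case: (f y); rewrite ?andbT ?andbF.
  move=> /(congr1 (fun n => n%:R : R)); rewrite natrD => <-; lra.
have total : #|[set y | f y] :\: H|%:R <= p * m%:R + t * (m %/ s).+1%:R.
  apply: le_trans (_ : \sum_(k < (m %/ s).+1) (p * #|F (inr k)|%:R + t) <= _).
    apply: le_trans (_ : (\sum_(k < (m %/ s).+1) #|[set y in F (inr k) | f y]|)%:R <= _).
      by rewrite ler_nat.
    by rewrite natr_sum; apply: ler_sum.
  rewrite big_split /= sumr_const card_ord -[t *+ _]mulr_natr lerD2r -mulr_sumr.
  by rewrite ler_wpM2l // -natr_sum ler_nat.
have mR : 1 <= m%:R / s%:R :> R by rewrite ler_pdivlMr // mul1r ler_nat.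
have ms : (m %/ s).+1%:R <= 2 * (m%:R / s%:R) :> R.
  rewrite -natr1.
  have : (m %/ s)%:R <= m%:R / s%:R :> R.
    by rewrite ler_pdivlMr // -natrM ler_nat leq_trunc_div.
  by lra.
have HR : #|H|%:R <= m%:R / s%:R :> R by rewrite ler_pdivlMr // -natrM ler_nat.
apply: le_trans (_ : (#|H| + #|[set y | f y] :\: H|)%:R <= _).
  have -> : H :|: [set y | f y] = H :|: ([set y | f y] :\: H).
    by apply/setP => y; rewrite !in_setU in_setD; case: (y \in H).
  by rewrite ler_nat leq_card_setU.
rewrite natrD.
have -> : a * m%:R = m%:R / s%:R + (p * m%:R + t * (2 * (m%:R / s%:R))).
  by rewrite /p; field; rewrite gt_eqF.
apply: lerD => //; apply: le_trans total _; rewrite lerD2l.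
exact: ler_wpM2l.
Qed.

(** * The lower bound on the guaranteed degree *)

Lemma exists_subset_card (T : finType) (S U : {set T}) (n : nat) :
  S \subset U -> (#|S| <= n <= #|U|)%N ->
  exists X : {set T}, [/\ S \subset X, X \subset U & #|X| = n].
Proof.
move=> SU /andP[Sn nU].
have : (n - #|S| <= #|U :\: S|)%N by rewrite cardsD (setIidPr SU) leq_sub2r.
case/card_geqP => r [ur sr rU].
have rD x : x \in r -> (x \in U) && (x \notin S) by move=> /rU; rewrite inE andbC.
exists (S :|: [set x in r]); split; first exact: subsetUl.
  by apply/subsetP => x; rewrite !inE => /orP[/(subsetP SU)|/rD/andP[]].
rewrite cardsU (_ : S :&: _ = set0) ?cards0 ?subn0 ?cardsE ?(card_uniqP ur) ?sr ?subnKC //.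
by apply/setP => x; rewrite !inE; apply/negP => /andP[xS /rD]; rewrite xS andbF.
Qed.

Lemma min_outdeg_le (V : finType) (G : digraph V) (x : V) :
  x \in vertices G -> (min_outdeg G <= outdeg G x)%N.
Proof.
by move=> xG; rewrite /min_outdeg -minEnat; apply: (bigmin_le_cond _ (outdeg G) xG).
Qed.

Lemma induced_exists (V : finType) (G : digraph V) (T : {set V}) (d : nat) :
  T \subset vertices G -> (0 < #|T|)%N ->
  (forall x, x \in T -> (d <= #|[set y in T | Defs.arc G x y]|)%N) ->
  exists H : digraph V, [/\ subdigraph H G, #|vertices H| = #|T| & (d <= min_outdeg H)%N].
Proof.
move=> TG T0 hd.
pose e x y := [&& x \in T, y \in T & Defs.arc G x y].
have ev x y : e x y -> (x \in T) && (y \in T) by case/and3P => -> ->.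
have ei : irreflexive e by move=> x; rewrite /e arc_irrefl !andbF.
exists (Digraph ev ei); split => //.
  by split=> //= x y /and3P[].
have outE x : x \in T -> outdeg (Digraph ev ei) x = #|[set y in T | Defs.arc G x y]|.
  by move=> xT; rewrite /outdeg /=; apply: eq_card => y; rewrite !inE /e xT.
apply: min_outdeg_leP => /= [|x xT]; last by rewrite outE // hd.
case/card_gt0P: T0 => x xT; apply: leq_trans (hd x xT) _; apply: subset_leq_card.
by apply/subsetP => y; rewrite inE => /andP[].
Qed.

(** The conclusion of [sparse_hitting_set] holds for all vertices, including
    those outside the set, hence survives any enlargement of the set to the
    prescribed size [n]. *)
Lemma guaranteed_of_tail (R : realType) (alpha t : R) (s d : nat) :
  1 < alpha -> (1 < s)%N -> 0 <= t ->
  0 <= alpha^-1 - s%:R^-1 - 2 * t / s%:R ->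
  expR (- (t ^+ 2 / (4 * s%:R))) < 2^-1 ->
  4 * expR (- (t ^+ 2 / (4 * s%:R))) * (s ^ 3)%:R <= 1 ->
  d%:R <= alpha^-1 * s%:R - 1 - 3 * t ->
  guaranteed alpha s d.
Proof.
move=> a1 s1 t0 p0 q2 q3 hd n n0 V G GE sG.
have a0 : 0 < alpha by apply: lt_trans a1.
have nm : (n <= #|vertices G|)%N by rewrite -lez_nat GE floor_ge_n.
have sm : (s < #|vertices G|)%N.
  by apply: leq_ltn_trans sG (min_outdeg_lt _); apply: leq_trans nm.
pose W := {x | x \in vertices G}.
have cW : #|{: W}| = #|vertices G| by rewrite card_sig; apply: eq_card => x; rewrite !inE.
have exN (x : W) : exists N : {set W}, N \subset [set y | Defs.arc G (val x) (val y)] /\ #|N| = s.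
  have : (s <= #|[set y : W | Defs.arc G (val x) (val y)]|)%N.
    apply: leq_trans sG _; apply: leq_trans (min_outdeg_le (valP x)) _.
    rewrite -(card_imset _ val_inj); apply: subset_leq_card.
    apply/subsetP => y; rewrite inE => xy.
    have /andP[_ yG] := arc_vertices xy.
    by apply/imsetP; exists (Sub y yG); rewrite ?inE.
  move=> sN.
  have cN : (#|set0 : {set W}| <= s <= #|[set y : W | Defs.arc G (val x) (val y)]|)%N.
    by rewrite cards0.
  have [N [_ NN Ns]] := exists_subset_card (sub0set _) cN.
  by exists N.
have [N hN] := fin_all_exists exN.
have Ns x : #|N x| = s by case: (hN x).
have sW : (s <= #|{: W}|)%N by rewrite cW ltnW.
have ai1 : alpha^-1 <= 1 by rewrite invf_le1 // ltW.
have [S [Sc Sd]] := sparse_hitting_set s1 sW Ns t0 ai1 p0 q2 q3.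
have Sn : (#|val @: S| <= n <= #|vertices G|)%N.
  rewrite nm andbT card_imset; last exact: val_inj.
  rewrite -(ler_nat R); apply: le_trans Sc _; rewrite cW.
  rewrite ler_pdivrMl //; have := floor_le (alpha * n%:R).
  by rewrite -GE pmulrn.
have SG : val @: S \subset vertices G.
  by apply/subsetP => _ /imsetP[y _ ->]; apply: valP.
have [T [ST TG Tn]] := exists_subset_card SG Sn.
rewrite -Tn; apply: induced_exists => //; first by rewrite Tn.
move=> x xT; have xG := subsetP TG x xT.
rewrite -(ler_nat R); apply: le_trans hd _.
apply: le_trans (Sd (Sub x xG)) _; rewrite ler_nat -(card_imset _ val_inj).
apply: subset_leq_card; apply/subsetP => _ /imsetP[y + ->].
rewrite !inE => /andP[yN yS]; rewrite (subsetP ST) ?imset_f //=.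
have [/subsetP/(_ y yN) + _] := hN (Sub x xG).
by rewrite inE.
Qed.

Lemma dmax_ge (R : realType) (alpha : R) (s d : nat) :
  1 < alpha -> guaranteed alpha s d -> (d <= dmax alpha s)%N.
Proof. by move=> a1 gd; have [_] := dmaxP s a1; apply. Qed.

Lemma ln_nat_bounds (R : realType) (s : nat) : (4 <= s)%N ->
  2^-1 <= ln (s%:R : R) <= 2 * Num.sqrt s%:R.
Proof.
move=> s4; have s0 : 0 < s%:R :> R by rewrite ltr0n; lia.
have s4R : 4 <= s%:R :> R by rewrite (ler_nat R 4 s).
apply/andP; split.
  have : ln (s%:R^-1 : R) <= s%:R^-1 - 1.
    have e : 1 + (s%:R^-1 - 1) = s%:R^-1 :> R by ring.
    rewrite -{1}e; apply: le_ln1Dx.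
    by have : 0 < s%:R^-1 :> R by [rewrite invr_gt0]; lra.
  rewrite lnV ?posrE //.
  have : s%:R^-1 <= 4^-1 :> R by rewrite lef_pV2 ?posrE //.
  lra.
have q0 : 0 < Num.sqrt (s%:R : R) by rewrite sqrtr_gt0.
rewrite -{1}(sqr_sqrtr (ltW s0)) lnXn // -[ln _ *+ 2]mulr_natl ler_wpM2l //.
exact/ltW/ln_sublinear.
Qed.

(** With [t = 4 * sqrt (s * ln s)] the tail is exactly [s ^ -4], which beats
    the [s ^ 3] dependencies. *)
Lemma dmax_lower_bound (R : realType) (alpha : R) : 1 < alpha ->
  exists s0 : nat, forall s : nat, (s0 <= s)%N ->
    s%:R / alpha - (dmax alpha s)%:R <= 16 * Num.sqrt (s%:R * ln s%:R).
Proof.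
move=> a1; pose a := alpha^-1; have a0 : 0 < a by rewrite invr_gt0; lra.
exists (4 + Num.truncn ((512 / a ^+ 2) ^+ 2))%N => s ss0.
have s4 : (4 <= s)%N by apply: leq_trans ss0; rewrite leq_addr.
have s0 : 0 < s%:R :> R by rewrite ltr0n; lia.
have s4R : 4 <= s%:R :> R by rewrite (ler_nat R 4 s).
have /andP[l1 l2] := ln_nat_bounds R s4.
set l := ln s%:R in l1 l2 *; set y := Num.sqrt s%:R in l2.
have y0 : 0 <= y by rewrite sqrtr_ge0.
have yE : y ^+ 2 = s%:R by rewrite sqr_sqrtr // ltW.
have ybig : 512 <= a ^+ 2 * y.
  rewrite -ler_pdivrMl ?exprn_gt0 // mulrC.
  rewrite -[_ <= y](@ler_pXn2r _ 2) ?nnegrE //; last by rewrite divr_ge0 ?sqr_ge0.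
  rewrite yE; apply: ltW; apply: lt_le_trans (truncnS_gt _) _.
  by rewrite ler_nat (leq_trans _ ss0) // -add1n leq_add2r.
pose t := 4 * Num.sqrt (s%:R * l).
have sl0 : 1 <= s%:R * l by nra.
have t4 : 4 <= t.
  have : 1 <= Num.sqrt (s%:R * l) by rewrite -[X in X <= _](sqrtr1 R) ler_sqrt //; lra.
  by rewrite /t; lra.
have tE : t ^+ 2 = 16 * (s%:R * l).
  by rewrite /t exprMn sqr_sqrtr; [ring | lra].
have ts : 4 * t <= a * s%:R.
  rewrite -[_ <= _](@ler_pXn2r _ 2) ?nnegrE //; [|lra|by rewrite mulr_ge0 // ltW].
  rewrite exprMn tE exprMn -yE.
  have : 0 <= y ^+ 2 * y by rewrite mulr_ge0 ?sqr_ge0.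
  have : 0 <= y ^+ 2 by apply: sqr_ge0.
  move=> h2 h3.
  apply: le_trans (_ : 512 * (y ^+ 2 * y) <= _); first by nra.
  have -> : a ^+ 2 * y ^+ 2 ^+ 2 = a ^+ 2 * y * (y ^+ 2 * y) by ring.
  by rewrite ler_wpM2r.
have eE : expR (- (t ^+ 2 / (4 * s%:R))) = (s%:R ^+ 4)^-1.
  have -> : t ^+ 2 / (4 * s%:R) = l * 4%:R.
    by rewrite tE; field; rewrite gt_eqF.
  by rewrite expRN expRM_natr /l lnK ?posrE.
have x0 : 0 <= a * s%:R - 1 - 3 * t by lra.
have := @guaranteed_of_tail R alpha t s (Num.truncn (a * s%:R - 1 - 3 * t)) a1.
have /andP[d1 d2] := truncn_itv x0.
have s1 : (1 < s)%N by apply: leq_trans s4.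
have t0 : 0 <= t by lra.
move=> /(_ s1 t0); rewrite eE => G.
have {}G : guaranteed alpha s (Num.truncn (a * s%:R - 1 - 3 * t)).
  apply: G d1.
  - rewrite -[alpha^-1]/a.
    have -> : a - s%:R^-1 - 2 * t / s%:R = (a * s%:R - 1 - 2 * t) / s%:R.
      by field; rewrite gt_eqF.
    by rewrite divr_ge0 ?ler0n //; lra.
  - rewrite ltf_pV2 ?posrE ?exprn_gt0 //.
    by apply: lt_le_trans (_ : 4 <= _); [lra|rewrite exprS; have : 1 <= s%:R ^+ 3 :> R by [apply: exprn_ege1; lra]; nra].
  - have -> : 4 * (s%:R ^+ 4)^-1 * (s ^ 3)%:R = 4 / s%:R :> R.
      by rewrite natrX; field; rewrite gt_eqF.
    by rewrite ler_pdivrMr // mul1r.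
have := dmax_ge a1 G; rewrite -(ler_nat R) => h.
rewrite -[(Num.truncn _).+1%:R]natr1 in d2.
rewrite -[alpha^-1]/a in d2 h *; rewrite [s%:R * a]mulrC.
by move: d2 h t4; rewrite /t; lra.
Qed.

(** * Anti-concentration of a random subset *)

Lemma central_bin_recurrence (n : nat) :
  (n.+1 * 'C(n.+1.*2, n.+1) = 2 * n.*2.+1 * 'C(n.*2, n))%N.
Proof.
rewrite doubleS binS.
have -> : 'C(n.*2.+1, n) = 'C(n.*2.+1, n.+1).
  rewrite -[LHS]bin_sub; last by lia.
  by congr binomial; lia.
rewrite addnn -mul2n mulnCA -mul_bin_diag /=; lia.
Qed.

Lemma central_bin_bound (n : nat) : (n.*2.+1 * 'C(n.*2, n) ^ 2 <= 16 ^ n)%N.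
Proof.
elim: n => // n IH; have E := central_bin_recurrence n.
rewrite -(@leq_pmul2l (n.+1 ^ 2)%N) ?expn_gt0 //.
apply: (@leq_trans (n.*2.+3 * (n.+1 * 'C(n.+1.*2, n.+1)) ^ 2)%N).
  by rewrite expnMn doubleS; nia.
rewrite E [(16 ^ n.+1)%N]expnS; move: IH; set b := 'C(_, _); set e := (16 ^ n)%N => IH.
apply: (@leq_trans ((n.*2.+3 * 4 * n.*2.+1) * (n.*2.+1 * b ^ 2))%N); first by nia.
apply: (@leq_trans ((n.*2.+3 * 4 * n.*2.+1) * e)%N); first by rewrite leq_mul2l IH orbT.
by rewrite mulnA leq_mul2r; apply/orP; right; nia.
Qed.

Lemma bin_le_succ (n k : nat) : (k.*2 < n)%N -> ('C(n, k) <= 'C(n, k.+1))%N.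
Proof.
move=> kn; rewrite -(@leq_pmul2l k.+1) // mul_bin_left.
by rewrite leq_mul2r; apply/orP; right; lia.
Qed.

Lemma bin_le_half (n k : nat) : ('C(n, k) <= 'C(n, n./2))%N.
Proof.
have low j : (j <= n./2)%N -> ('C(n, j) <= 'C(n, n./2))%N.
  move=> jn; rewrite -(subKn jn); move: (_ - j)%N (leq_subr j n./2) => i.
  elim: i => [|i IH] ih; first by rewrite subn0.
  apply: leq_trans (IH (ltnW ih)).
  by have -> : (n./2 - i = (n./2 - i.+1).+1)%N; [lia|apply: bin_le_succ; lia].
have [kn|nk] := leqP k n; last by rewrite bin_small.
have [/low//|h] := leqP k n./2.
by rewrite -bin_sub //; apply: low; lia.
Qed.

(** The central binomial bound: a binomial coefficient is at most
    [2 ^ n / sqrt n], stated without square roots. *)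
Lemma bin_square_bound (n k : nat) : (n * 'C(n, k) ^ 2 <= 4 ^ n)%N.
Proof.
apply: (@leq_trans (n * 'C(n, n./2) ^ 2)%N); first by rewrite leq_mul2l leq_exp2r // bin_le_half orbT.
have pow j : (4 ^ j.*2 = 16 ^ j)%N by rewrite -mul2n expnM.
case: (boolP (odd n)) => on; last first.
  have {1 2 4}-> : n = n./2.*2 by rewrite even_halfK.
  rewrite pow; apply: leq_trans (central_bin_bound n./2).
  by rewrite leq_mul2r leqnSn orbT.
have nE : n = n./2.*2.+1 by rewrite odd_halfK // prednK // odd_gt0.
set i := n./2 in nE *; rewrite nE.
have := central_bin_bound i.+1; have := central_bin_recurrence i.
have := @mul_bin_diag i.*2.+1 i; rewrite /= => E1.
have -> : 'C(i.*2.+1, i) = 'C(i.*2.+1, i.+1).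
  rewrite -[LHS]bin_sub; last by lia.
  by congr binomial; lia.
rewrite doubleS binS.
have -> : 'C(i.*2.+1, i) = 'C(i.*2.+1, i.+1).
  rewrite -[LHS]bin_sub; last by lia.
  by congr binomial; lia.
move=> _; rewrite addnn !expnS pow.
set b := 'C(_, _); set e := (16 ^ i)%N; rewrite !expn0; nia.
Qed.

(** A set [E] is determined by its trace outside [T] and by the set of points
    of [T] where it agrees with [w]. *)
Lemma card_level (C : finType) (T : {set C}) (w : pred C) (j : nat) :
  (#|[set E : {set C} | #|[set c in T | (c \in E) == w c]| == j]|
    <= 'C(#|T|, j) * 2 ^ #|~: T|)%N.
Proof.
pose g (E : {set C}) := ([set c in T | (c \in E) == w c], E :\: T).
rewrite -(card_in_imset (f := g)); last first.
  move=> E E' _ _ [/setP h1 /setP h2]; apply/setP => c.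
  have := h1 c; have := h2 c; rewrite !inE; case: (c \in T) => //= _.
  by case: (c \in E); case: (c \in E'); case: (w c).
rewrite -cards_draws -card_powerset -cardsX; apply: subset_leq_card.
apply/subsetP => _ /imsetP[E + ->]; rewrite !inE /= => ->; rewrite andbT.
apply/andP; split; first by apply/subsetP => c; rewrite inE => /andP[].
by apply/subsetP => c; rewrite !inE => /andP[].
Qed.

(** At most a fraction [L / sqrt #|T|] of the subsets [E] of [C] agree with [w]
    on a number of points of [T] that lies in a given window of length [L]. *)
Lemma card_window (C : finType) (T : {set C}) (w : pred C) (P : pred nat) (lo L : nat) :
  (forall j, P j -> lo <= j < lo + L)%N ->
  (#|[set E : {set C} | P #|[set c in T | (c \in E) == w c]|]| ^ 2 * #|T|
    <= L ^ 2 * 4 ^ #|C|)%N.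
Proof.
move=> hP; pose lev (E : {set C}) := #|[set c in T | (c \in E) == w c]|.
have h1 : (#|[set E | P (lev E)]| <= L * ('C(#|T|, #|T|./2) * 2 ^ #|~: T|))%N.
  apply: leq_trans (_ : #|\bigcup_(i < L) [set E | lev E == lo + i]%N| <= _)%N.
    apply: subset_leq_card; apply/subsetP => E; rewrite inE => /hP/andP[h1 h2].
    have iL : (lev E - lo < L)%N by rewrite ltn_subLR.
    by apply/bigcupP; exists (Ordinal iL) => //; rewrite inE /= subnKC.
  apply: leq_trans (leq_card_bigcup _ _) _.
  rewrite -[X in (_ <= X * _)%N]card_ord -sum_nat_const; apply: leq_sum => i _.
  apply: leq_trans (card_level T w (lo + i)) _.
  by rewrite leq_mul2r bin_le_half orbT.
apply: leq_trans (_ : (L * ('C(#|T|, #|T|./2) * 2 ^ #|~: T|)) ^ 2 * #|T| <= _)%N.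
  by rewrite leq_mul2r leq_exp2r // h1 orbT.
have := bin_square_bound #|T| #|T|./2; rewrite -(cardsC T) expnD.
have -> : (4 ^ #|~: T| = (2 ^ #|~: T|) ^ 2)%N by rewrite -!expnM mulnC expnM.
set b := 'C(_, _); set q := (2 ^ _)%N => h.
have := leq_mul (leqnn (L ^ 2 * q ^ 2)%N) h.
by congr (_ <= _)%N; rewrite ?expnMn; ring.
Qed.

(** * A union bound for random matrices with independent rows *)

Lemma card_set_type (T : finType) : #|{: {set T}}| = (2 ^ #|T|)%N.
Proof. by have := card_powerset [set: T]; rewrite powersetT !cardsT. Qed.

Lemma card_rows_bad (Row Col : finType) (bad : Row -> {set {set Col}}) (e : nat) (Q : {set Row}) :
  (forall r, #|bad r| * 2 ^ e <= 2 ^ #|Col|)%N ->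
  (#|[set g : {ffun Row -> {set Col}} | [forall r in Q, g r \in bad r]]| * 2 ^ (e * #|Q|)
    <= 2 ^ (#|Col| * #|Row|))%N.
Proof.
move=> hb; pose F r := if r \in Q then bad r else setT.
have -> : #|[set g : {ffun Row -> {set Col}} | [forall r in Q, g r \in bad r]]|
    = (\prod_r #|F r|)%N.
  rewrite -[RHS](_ : #|family (fun r => mem (F r))| = _); last first.
    by rewrite card_family foldrE big_map -big_enum.
  rewrite cardsE; apply: eq_card => g; rewrite -!topredE /=.
  apply: eq_forallb => r.
  by rewrite /F; case: (r \in Q) => //=; rewrite inE.
rewrite expnM -sum1_card [in X in (_ * X)%N]big_mkcond /=.
have -> : ((2 ^ e) ^ (\sum_(i : Row) (if i \in Q then 1 else 0)) = \prod_i (if i \in Q then 2 ^ e else 1))%N.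
  elim/big_rec2: _ => // i y x _ <-; case: ifP => _; first by rewrite expnS.
  by rewrite mul1n.
rewrite -big_split /= expnM -[X in (_ <= _ ^ X)%N]sum1_card expn_sum.
apply: leq_prod => r _; rewrite expn1 /F; case: ifP => _; first exact: hb.
by rewrite muln1 cardsT card_set_type.
Qed.

(** First moment: fix [i] in [Sg] and a set [Q] of at least [rho] rows; the
    rows being independent, all those of [Q] are bad with probability at most
    [2 ^ - (e * rho)], and there are [#|Sg| * 2 ^ #|Row|] choices. *)
Lemma exists_avoiding_matrix (Row Col Sg : finType) (bad : Sg -> Row -> {set {set Col}})
    (e rho : nat) :
  (forall i r, #|bad i r| * 2 ^ e <= 2 ^ #|Col|)%N ->
  (#|Sg| * 2 ^ #|Row| < 2 ^ (e * rho))%N ->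
  exists g : {ffun Row -> {set Col}}, forall i, (#|[set r | g r \in bad i r]| < rho)%N.
Proof.
move=> hb hlt.
suff /existsP[g /forallP hg] : [exists g : {ffun Row -> {set Col}},
    [forall i, #|[set r | g r \in bad i r]| < rho]]%N by exists g.
move: hlt; rewrite ltnNge; apply: contraR; rewrite negb_exists => /forallP no.
pose B (iQ : Sg * {set Row}) := if (rho <= #|iQ.2|)%N then
  [set g : {ffun Row -> {set Col}} | [forall r in iQ.2, g r \in bad iQ.1 r]] else set0.
have cov : [set: {ffun Row -> {set Col}}] \subset \bigcup_iQ B iQ.
  apply/subsetP => g _; have := no g; rewrite negb_forall => /existsP[i].
  rewrite -leqNgt => hi; apply/bigcupP; exists (i, [set r | g r \in bad i r]) => //.
  rewrite /B /= hi inE; apply/forall_inP => r; by rewrite inE.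
have tot : (#|[set: {ffun Row -> {set Col}}]| = 2 ^ (#|Col| * #|Row|))%N.
  by rewrite cardsT card_ffun card_set_type expnM.
rewrite -(@leq_pmul2l (2 ^ (#|Col| * #|Row|))%N) ?expn_gt0 //.
rewrite -{1}tot.
apply: leq_trans (leq_mul (leq_trans (subset_leq_card cov) (leq_card_bigcup _ _)) (leqnn _)) _.
rewrite big_distrl /=.
apply: leq_trans (_ : (\sum_(iQ : Sg * {set Row}) 2 ^ (#|Col| * #|Row|) <= _)%N).
  apply: leq_sum => -[i Q] _; rewrite /B /=; case: ifP => hQ; last by rewrite cards0.
  apply: leq_trans (card_rows_bad Q (hb i)); rewrite leq_mul2l; apply/orP; right.
  by rewrite leq_exp2l // leq_mul2l hQ orbT.
rewrite sum_nat_const card_prod mulnC leq_mul2l; apply/orP; right.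
by rewrite card_set_type.
Qed.

(** * A regular multipartite tournament driven by a bit matrix *)

(** Part, position in the part and side.  A part consists of two sides that
    are copies of the cyclic group of order [h'.+1]. *)
Definition vertex (r h' : nat) : finType := ('I_r * 'I_h'.+1 * bool)%type.
(** A pair of vertices on the two sides of one part, see [seen_slot]; also the
    index of a row and of a column of the bit matrix. *)
Definition slot (r h' : nat) : finType := ('I_r * 'I_h'.+1)%type.

Definition part (r h' : nat) (x : vertex r h') : 'I_r := x.1.1.
Definition own_slot (r h' : nat) (x : vertex r h') : slot r h' := x.1.

(** Seen from part [a], position [Q] of side [false] is paired with position
    [Q + a] of side [true], and this pair is named after [Q].  As [a] varies,
    these pairings decompose the complete bipartite graph between the sides. *)
Definition seen_slot (r h' : nat) (a : 'I_r) (y : vertex r h') : slot r h' :=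
  (y.1.1, y.1.2 - (if y.2 then inZp a else 0)).

Definition slot_vertex (r h' : nat) (a : 'I_r) (cv : slot r h' * bool) : vertex r h' :=
  (cv.1.1, cv.1.2 + (if cv.2 then inZp a else 0), cv.2).

(** Orientation from an earlier part to a later one.  It changes with the side
    of either end, which makes the tournament regular; it is random exactly
    from the first [h'.+1] parts to the others.  So each bit that matters for
    the row of [x] is used by the vertices above a single slot, and different
    rows of the matrix do not interact. *)
Definition forward (r h' : nat) (g : {ffun slot r h' -> {set slot r h'}})
    (x y : vertex r h') : bool :=
  x.2 (+) y.2 (+)
  [&& (part x < h'.+1)%N, (h'.+1 <= part y)%N & seen_slot (part x) y \in g (own_slot x)].

Definition tarc (r h' : nat) (g : {ffun slot r h' -> {set slot r h'}}) : rel (vertex r h') :=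
  fun x y => ((part x < part y)%N && forward g x y)
          || ((part y < part x)%N && ~~ forward g y x).

Definition degree_in (r h' : nat) (g : {ffun slot r h' -> {set slot r h'}})
    (S : {set vertex r h'}) (x : vertex r h') : nat :=
  #|[set y in S | tarc g x y]|.

Lemma seen_slot_vertex (r h' : nat) (a : 'I_r) (cv : slot r h' * bool) :
  seen_slot a (slot_vertex a cv) = cv.1.
Proof. by case: cv => [[b Q] v]; rewrite /seen_slot /= addrK. Qed.

Lemma slot_vertexK (r h' : nat) (a : 'I_r) :
  cancel (@slot_vertex r h' a) (fun y => (seen_slot a y, y.2)).
Proof. by move=> [[b Q] v]; rewrite /seen_slot /= addrK. Qed.

Lemma seen_slotK (r h' : nat) (a : 'I_r) :
  cancel (fun y => (seen_slot a y, y.2)) (@slot_vertex r h' a).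
Proof. by move=> [[b Q] v]; rewrite /slot_vertex /= subrK. Qed.

Lemma tarc_irrefl (r h' : nat) (g : {ffun slot r h' -> {set slot r h'}}) : irreflexive (tarc g).
Proof. by move=> x; rewrite /tarc ltnn. Qed.

Lemma tarc_skew (r h' : nat) (g : {ffun slot r h' -> {set slot r h'}}) (x y : vertex r h') :
  (tarc g x y + tarc g y x = (part x != part y))%N.
Proof.
rewrite /tarc -val_eqE /=; case: ltngtP => _ /=; rewrite ?orbF;
  by case: (forward g _ _).
Qed.

(** For fixed [x], an involution that reverses the orientation between [x]
    and [y]: later parts are paired as [x] sees them, while an earlier part
    has bits that depend only on the position of [y], not on its side. *)
Definition partner (r h' : nat) (x y : vertex r h') : vertex r h' :=
  if (part x < part y)%N then slot_vertex (part x) (seen_slot (part x) y, ~~ y.2)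
  else (y.1, ~~ y.2).

Lemma part_partner (r h' : nat) (x y : vertex r h') : part (partner x y) = part y.
Proof. by rewrite /partner; case: ifP. Qed.

Lemma partnerK (r h' : nat) (x : vertex r h') : involutive (partner x).
Proof.
move=> y; rewrite {1}/partner part_partner; case: ifP => xy; rewrite /partner xy.
  by rewrite seen_slot_vertex negbK; apply: (seen_slotK (part x) y).
by case: y {xy} => [[b Q] v] /=; rewrite negbK.
Qed.

Lemma tarc_partner (r h' : nat) (g : {ffun slot r h' -> {set slot r h'}}) (x y : vertex r h') :
  part x != part y -> tarc g x (partner x y) = ~~ tarc g x y.
Proof.
rewrite /tarc !part_partner -val_eqE /=.
rewrite /partner; case: ltngtP => // h _ /=; rewrite ?orbF.
  by rewrite /forward seen_slot_vertex /= addbN addNb.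
by rewrite /forward /part /own_slot /=; congr (~~ _); rewrite !addNb.
Qed.

Lemma card_part (r h' : nat) (a : 'I_r) :
  #|[set y : vertex r h' | part y == a]| = (2 * h'.+1)%N.
Proof.
rewrite (_ : [set y | _] = setX (setX [set a] setT) setT).
  by rewrite !cardsX cards1 !cardsT card_ord card_bool mul1n mulnC.
by apply/setP => -[[b i] u]; rewrite !inE /part /= !andbT.
Qed.

Lemma card_vertex (r h' : nat) : #|{: vertex r h'}| = (2 * r * h'.+1)%N.
Proof. by rewrite !card_prod !card_ord card_bool; ring. Qed.

(** Each vertex points to exactly one vertex of each pair of partners. *)
Lemma tarc_regular (r h' : nat) (g : {ffun slot r h' -> {set slot r h'}}) (x : vertex r h') :
  #|[set y | tarc g x y]| = (r.-1 * h'.+1)%N.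
Proof.
pose A := [set y | tarc g x y]; pose B := [set y | (part x != part y) && ~~ tarc g x y].
have AB : #|A| = #|B|.
  rewrite -(card_imset _ (inv_inj (partnerK x))); apply: eq_card => y.
  rewrite -[y in LHS](partnerK x) mem_imset; last exact: inv_inj (partnerK x).
  rewrite !inE; have [xy|xy] := eqVneq (part x) (part y).
    by rewrite /tarc part_partner xy ltnn.
  by rewrite tarc_partner.
have : (#|A| + #|B| = #|[set y : vertex r h' | part x != part y]|)%N.
  rewrite -(cardsID A [set y | part x != part y]); congr (_ + _)%N; apply: eq_card => y.
    rewrite !inE; have [xy|//] := eqVneq (part x) (part y).
    by rewrite /tarc xy ltnn.
  by rewrite !inE andbC.
have := cardsC [set y : vertex r h' | part y == part x]; rewrite card_part card_vertex.
have -> : ~: [set y : vertex r h' | part y == part x] = [set y | part x != part y].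
  by apply/setP => y; rewrite !inE eq_sym.
have : (0 < r)%N by apply: leq_ltn_trans (ltn_ord (part x)).
move=> r0; have rE : (r * h'.+1 = r.-1 * h'.+1 + h'.+1)%N.
  by rewrite -{1}(prednK r0) mulSn addnC.
by rewrite -AB -/A -mulnA rE; lia.
Qed.

(* --- degrees along a own_slot --- *)
(** The pairs, as seen from part [a] in the random range, of which [S] contains
    exactly one vertex. *)
Definition cut_slots (r h' : nat) (S : {set vertex r h'}) (a : 'I_r) : {set slot r h'} :=
  [set c : slot r h' | (h'.+1 <= c.1)%N &&
    ((slot_vertex a (c, false) \in S) != (slot_vertex a (c, true) \in S))].

(** As a function of the matrix, the degree of [x] into [S] depends only on
    the row of [x]: an uncut pair contributes a constant, a cut one contributes
    1 or 0 according to its bit. *)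
Lemma degree_in_row (r h' : nat) (S : {set vertex r h'}) (x : vertex r h') :
  (part x < h'.+1)%N ->
  exists c0 : nat, exists w : pred (slot r h'), forall g,
    degree_in g S x =
    (c0 + #|[set c in cut_slots S (part x) | (c \in g (own_slot x)) == w c]|)%N.
Proof.
move=> ah; pose g0 : {ffun slot r h' -> {set slot r h'}} := [ffun=> set0].
pose s (c : slot r h') (v : bool) := slot_vertex (part x) (c, v) \in S.
(* The constant comes from the first parts, where the matrix is not used
   and may be replaced by 0, and from the pairs contained in [S]. *)
exists (#|[set y in S | (part y < h'.+1)%N && tarc g0 x y]| +
   #|[set c : slot r h' | (h'.+1 <= c.1)%N && (s c false && s c true)]|)%N.
exists (fun c => ~~ (x.2 (+) s c true)) => g.
rewrite /degree_in -(cardsID [set y : vertex r h' | (part y < h'.+1)%N]) -addnA.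
congr (_ + _)%N.
  apply: eq_card => y; rewrite !inE -!andbA; congr (_ && _); rewrite [RHS]andbC.
  case: ltnP => yh; rewrite ?andbF // !andbT /tarc /forward.
  have -> : (h'.+1 <= part y)%N = false by rewrite leqNgt yh.
  have -> : (h'.+1 <= part x)%N = false by rewrite leqNgt ah.
  by rewrite /= !andbF.
rewrite -!sum1_card.
rewrite big_mkcond (reindex (@slot_vertex r h' (part x))) /=; last first.
  exists (fun y => (seen_slot (part x) y, y.2)) => y _; first exact: slot_vertexK.
  exact: seen_slotK.
rewrite -(pair_bigA _ (fun c v => if slot_vertex (part x) (c, v) \in _ then 1 else 0)%N) /=.
rewrite [X in _ = (X + _)%N]big_mkcond [X in _ = (_ + X)%N]big_mkcond -big_split /=.
apply: eq_bigr => c _; rewrite big_bool !inE -/(s c false) -/(s c true) /=.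
rewrite -leqNgt {1 2}/part /=; case: leqP => hc //=.
have xc : (part x < c.1)%N by apply: leq_trans hc.
have tE v : tarc g x (slot_vertex (part x) (c, v)) = x.2 (+) v (+) (c \in g (own_slot x)).
  rewrite /tarc /forward {2 4 6 8}/part /= xc ah hc ltnNge (ltnW xc) orbF /=.
  by rewrite seen_slot_vertex.
rewrite !tE; case: (s c true); case: (s c false) => //=;
  by case: (x.2); case: (c \in g (own_slot x)).
Qed.

(** * A matrix with few rows of concentrated degrees *)

Definition part_size (r h' : nat) (S : {set vertex r h'}) (a : 'I_r) : nat :=
  #|[set y in S | part y == a]|.

(** In a vertex set of size [N] a vertex in a part of size [q] has
    [(N - q) / 2] expected out-neighbours; flat means that twice the degree
    [d] is within [W] of twice this number. *)
Definition flat_degree (W N q d : nat) : bool :=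
  ((N <= d.*2 + q + W) && (d.*2 + q <= N + W))%N.

Definition flat (r h' : nat) (g : {ffun slot r h' -> {set slot r h'}}) (W : nat)
    (S : {set vertex r h'}) (x : vertex r h') : bool :=
  flat_degree W #|S| (part_size S (part x)) (degree_in g S x).

Lemma flat_degree_window (W N q c j : nat) :
  flat_degree W N q (c + j) ->
  (uphalf (N - (c.*2 + q + W)) <= j < uphalf (N - (c.*2 + q + W)) + W.+1)%N.
Proof. by rewrite /flat_degree doubleD; lia. Qed.

(** A flat degree in a row with at least [K] cut pairs is a bad row for the
    union bound; the index runs over the sets [S] and the two sides [u], since
    the two vertices of a row on different sides use the same bits. *)
Lemma exists_good_tournament (r h' W K e rho : nat) :
  (W.+1 ^ 2 * 4 ^ e <= K)%N -> (3 * (r * h'.+1) + 1 < e * rho)%N ->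
  exists g : {ffun slot r h' -> {set slot r h'}}, forall S u,
    (#|[set c : slot r h' | [&& (c.1 < h'.+1)%N, (K <= #|cut_slots S c.1|)%N
          & flat g W S (c, u)]]| < rho)%N.
Proof.
move=> WK er.
have exc S u (c : slot r h') : exists p : nat * pred (slot r h'), (c.1 < h'.+1)%N -> forall g,
    degree_in g S (c, u) = (p.1 + #|[set d in cut_slots S c.1 | (d \in g c) == p.2 d]|)%N.
  have [ch|] := boolP (c.1 < h'.+1)%N; last by exists (0%N, xpredT).
  by have [c0 [w hw]] := @degree_in_row r h' S (c, u) ch; exists (c0, w).
pose idx := ({set vertex r h'} * bool)%type.
have exf : forall ic : idx * slot r h', exists p : nat * pred (slot r h'),
    (ic.2.1 < h'.+1)%N -> forall g, degree_in g ic.1.1 (ic.2, ic.1.2) =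
      (p.1 + #|[set d in cut_slots ic.1.1 ic.2.1 | (d \in g ic.2) == p.2 d]|)%N.
  by move=> [[S u] c]; apply: exc.
have [f hf] := fin_all_exists exf.
pose bad (i : idx) (c : slot r h') : {set {set slot r h'}} :=
  if (c.1 < h'.+1)%N && (K <= #|cut_slots i.1 c.1|)%N then
    [set E : {set slot r h'} | flat_degree W #|i.1| (part_size i.1 c.1)
      ((f (i, c)).1 + #|[set d in cut_slots i.1 c.1 | (d \in E) == (f (i, c)).2 d]|)%N]
  else set0.
have [i c||g hg] := @exists_avoiding_matrix (slot r h') (slot r h') idx bad e rho.
- rewrite /bad; case: ifP => [/andP[_ hK]|_]; last by rewrite cards0.
  have := @card_window _ (cut_slots i.1 c.1) (f (i, c)).2
    (fun j => flat_degree W #|i.1| (part_size i.1 c.1) ((f (i, c)).1 + j)%N) _ _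
    (fun j hj => flat_degree_window hj).
  move=> hB.
  rewrite -(@leq_exp2r _ _ 2) // expnMn.
  rewrite -(@leq_pmul2l (W.+1 ^ 2)%N) ?expn_gt0 //.
  have pw k : ((2 ^ k) ^ 2 = 4 ^ k)%N by rewrite -!expnM mulnC expnM.
  rewrite !pw; apply: leq_trans hB.
  by rewrite mulnCA leq_mul2l (leq_trans WK hK) orbT.
- rewrite card_prod card_set_type card_vertex card_bool !card_prod !card_ord.
  rewrite -[X in (_ * X * _)%N]expn1 -!expnD ltn_exp2l //.
  by apply: leq_trans er; rewrite ltnS; lia.
exists g => S u; apply: leq_trans (hg (S, u)); rewrite ltnS; apply: subset_leq_card.
apply/subsetP => c; rewrite !inE /bad => /and3P[ch cK]; rewrite ch cK inE /flat.
by rewrite (hf ((S, u), c) ch).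
Qed.

(** * Counting identities in a vertex set *)

(** Two vertices of [S] in different parts span exactly one arc. *)
Lemma sum_degree_in (r h' : nat) (g : {ffun slot r h' -> {set slot r h'}})
    (S : {set vertex r h'}) :
  (\sum_(x in S) ((degree_in g S x).*2 + part_size S (part x)) = #|S| * #|S|)%N.
Proof.
have degE x : degree_in g S x = (\sum_(y in S) tarc g x y)%N.
  rewrite /degree_in -sum1_card [LHS]big_mkcond [RHS]big_mkcond; apply: eq_bigr => y _.
  by rewrite inE; case: (y \in S) => //=; case: (tarc g x y).
have sizeE a : part_size S a = (\sum_(y in S) (part y == a))%N.
  rewrite /part_size -sum1_card [LHS]big_mkcond [RHS]big_mkcond; apply: eq_bigr => y _.
  by rewrite inE; case: (y \in S) => //=; case: (part y == a).
under eq_bigr => x _ do rewrite degE sizeE -addnn.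
rewrite !big_split /= [X in (_ + X + _)%N]exchange_big -!big_split /=.
rewrite -sum_nat_const; apply: eq_bigr => x _; rewrite -!big_split -sum1_card /=.
by apply: eq_bigr => y _; rewrite tarc_skew eq_sym; case: (part y == part x).
Qed.

Lemma sum_over_parts (V : nmodType) (r h' : nat) (S : {set vertex r h'}) (F : 'I_r -> V) :
  \sum_(x in S) F (part x) = \sum_a F a *+ part_size S a.
Proof.
rewrite (partition_big (fun x : vertex r h' => part x) xpredT) //=; apply: eq_bigr => a _.
rewrite /part_size -sumr_const; apply: eq_big => [x|x /andP[_ /eqP ->]] //.
by rewrite inE.
Qed.

Lemma part_size_le (r h' : nat) (S : {set vertex r h'}) (a : 'I_r) :
  (part_size S a <= 2 * h'.+1)%N.
Proof.
rewrite -(card_part h' a); apply: subset_leq_card; apply/subsetP => y.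
by rewrite !inE => /andP[].
Qed.

Definition half_part (r h' : nat) (S : {set vertex r h'}) (b : 'I_r) (v : bool) : {set 'I_h'.+1} :=
  [set j | (b, j, v) \in S].

Lemma card_half_parts (r h' : nat) (S : {set vertex r h'}) (b : 'I_r) :
  (#|half_part S b false| + #|half_part S b true| = part_size S b)%N.
Proof.
rewrite /part_size -(cardsID [set y : vertex r h' | y.2]) addnC.
have inj (v : bool) : injective (fun j : 'I_h'.+1 => (b, j, v)) by move=> i j [].
congr (_ + _)%N.
  rewrite -(card_imset _ (inj true)); apply: eq_card => -[[b' j] v]; rewrite !inE.
  apply/imsetP/idP => [[i]|/andP[/andP[hS /eqP bb] /= vT]].
    by rewrite inE => bi [-> -> ->]; rewrite bi /part /= eqxx.
  by exists j; rewrite ?inE -?bb -?vT.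
rewrite -(card_imset _ (inj false)); apply: eq_card => -[[b' j] v]; rewrite !inE.
apply/imsetP/idP => [[i]|/andP[/= vF /andP[hS /eqP bb]]].
  by rewrite inE => bi [-> -> ->]; rewrite bi /part /= eqxx.
by exists j; rewrite ?inE -?bb -?(negbTE vF).
Qed.

Lemma card_neq_pairs (T : finType) (A B : {set T}) :
  (\sum_(i : T) \sum_(j : T) ((i \in A) != (j \in B)) = #|A| * #|~: B| + #|~: A| * #|B|)%N.
Proof.
rewrite (bigID (mem A)) /=; congr (_ + _)%N.
  rewrite -sum_nat_const; apply: eq_bigr => i iA; rewrite iA -sum1_card [RHS]big_mkcond.
  by apply: eq_bigr => j _; rewrite inE; case: (j \in B).
rewrite (eq_bigl (mem (~: A))); last by move=> i; rewrite /= inE.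
rewrite -sum_nat_const; apply: eq_bigr => i iA.
have -> : (i \in A) = false by apply: negbTE; move: iA; rewrite /= inE.
by rewrite -sum1_card [RHS]big_mkcond; apply: eq_bigr => j _; case: (j \in B).
Qed.

(** The pairings seen from the first [h'.+1] parts cover every pair of
    positions on opposite sides of part [b] exactly once, so the number of cut
    pairs can be read off from the numbers of elements on the sides. *)
Lemma sum_cut_slots (r h' : nat) (S : {set vertex r h'}) : (h'.+1 <= r)%N ->
  (\sum_(a : 'I_r | a < h'.+1) #|cut_slots S a| =
   \sum_(b : 'I_r | h'.+1 <= b)
     (#|half_part S b false| * #|~: half_part S b true| +
      #|~: half_part S b false| * #|half_part S b true|))%N.
Proof.
move=> hr.
have cutE (a : 'I_r) : #|cut_slots S a| = (\sum_(b : 'I_r | h'.+1 <= b)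
    \sum_(j : 'I_h'.+1) ((j \in half_part S b false) != ((j + inZp a)%R \in half_part S b true)))%N.
  rewrite pair_big_dep /= -sum1_card [LHS]big_mkcond [RHS]big_mkcond.
  apply: eq_bigr => -[b j] _; rewrite /cut_slots /half_part !inE /slot_vertex /= addr0.
  by rewrite andbT; case: leqP => //= _; case: (_ != _).
under eq_bigr => a _ do rewrite cutE.
rewrite exchange_big /=; apply: eq_bigr => b _.
rewrite -card_neq_pairs exchange_big /=; apply: eq_bigr => j _.
rewrite (big_ord_narrow hr) /= [RHS](reindex (fun i : 'I_h'.+1 => (j + i)%R)) /=; last first.
  by exists (fun i => (i - j)%R) => i _; [rewrite addrC addKr | rewrite addrC subrK].
apply: eq_bigr => a _.
have -> // : inZp (widen_ord hr a) = a :> 'I_h'.+1.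
by apply: val_inj; rewrite /= modn_small.
Qed.

(** * Large minimum degree forces balance and concentration *)

Definition deviation (R : realFieldType) (r h' : nat) (S : {set vertex r h'}) (a : 'I_r) : R :=
  (part_size S a)%:R - #|S|%:R / r%:R.

Lemma sum_part_size (r h' : nat) (S : {set vertex r h'}) :
  (\sum_a part_size S a = #|S|)%N.
Proof.
have := @sum_over_parts nat r h' S (fun _ => 1%N); rewrite sum1_card => ->.
by apply: eq_bigr => a _; rewrite natn.
Qed.

Lemma sum_deviation (R : realFieldType) (r h' : nat) (S : {set vertex r h'}) : (0 < r)%N ->
  \sum_a deviation R S a = 0.
Proof.
move=> r0; have rn : r%:R != 0 :> R by rewrite pnatr_eq0 -lt0n.
rewrite /deviation big_split /= sumr_const card_ord -natr_sum sum_part_size.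
by rewrite -[(- _) *+ _]mulr_natr mulNr divfK // subrr.
Qed.

Lemma card_set_vertex_le (R : realFieldType) (r h' : nat) (S : {set vertex r h'}) :
  #|S|%:R <= 2 * r%:R * h'.+1%:R :> R.
Proof. by rewrite -!natrM ler_nat -card_vertex max_card. Qed.

(** In this section all degrees in [S] are at least their average minus
    [gam ^+ 4 * h].  The excess of [x] is twice the difference between its
    degree and the degree expected from the size of its part; the excesses add
    up to 0. *)
Section Spread.
Context (R : realFieldType) (r h' W : nat) (g : {ffun slot r h' -> {set slot r h'}}).
Context (S : {set vertex r h'}) (gam : R).
Context (r0 : (0 < r)%N) (gam01 : 0 < gam <= 1).
Local Notation N := (#|S|%:R : R).
Local Notation h := (h'.+1%:R : R).
Local Notation dev := (deviation R S).
Context (rich : forall x, x \in S ->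
  N * (1 - r%:R^-1) / 2 - gam ^+ 4 * h <= (degree_in g S x)%:R).

Let excess (x : vertex r h') : R :=
  2 * (degree_in g S x)%:R + (part_size S (part x))%:R - N.

Let h_gt0 : 0 < h. Proof. by rewrite ltr0n. Qed.
Let gam_gt0 : 0 < gam. Proof. by case/andP: gam01. Qed.
Let gam_le1 : gam <= 1. Proof. by case/andP: gam01. Qed.
Let gam4h : 0 <= gam ^+ 4 * h. Proof. by rewrite mulr_ge0 ?exprn_ge0 // ltW. Qed.
Let h1_neq0 : 1 + h'%:R != 0 :> R. Proof. by rewrite nat1r pnatr_eq0. Qed.
Let r_gt0 : 0 < r%:R :> R. Proof. by rewrite ltr0n. Qed.

Let sum_excess : \sum_(x in S) excess x = 0.
Proof.
rewrite /excess big_split /= sumr_const.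
have := congr1 (fun n => n%:R : R) (sum_degree_in g S).
rewrite natr_sum natrM => E.
rewrite mulNrn -[N *+ _]mulr_natr -E -sumrB big1 // => x _.
by rewrite natrD -addnn natrD; ring.
Qed.

Let excess_ge (x : vertex r h') : x \in S -> dev (part x) - 2 * gam ^+ 4 * h <= excess x.
Proof.
move=> /rich; rewrite /excess /deviation.
have -> : N * (1 - r%:R^-1) / 2 = N / 2 - (N / r%:R) / 2 by field; rewrite gt_eqF.
lra.
Qed.

Let size_le (a : 'I_r) : (part_size S a)%:R <= 2 * h.
Proof. by rewrite -natrM ler_nat part_size_le. Qed.

Let sum_dev_sqr : \sum_a dev a ^+ 2 <= 4 * gam ^+ 4 * r%:R * h ^+ 2.
Proof.
have : \sum_(x in S) (dev (part x) - 2 * gam ^+ 4 * h) <= 0.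
  by rewrite -[leRHS]sum_excess; apply: ler_sum.
rewrite big_split /= sum_over_parts sumr_const.
have -> : \sum_a dev a *+ part_size S a = \sum_a dev a ^+ 2.
  transitivity (\sum_a (dev a ^+ 2 + dev a * (N / r%:R))).
    by apply: eq_bigr => a _; rewrite -mulr_natr /deviation; ring.
  by rewrite big_split /= -mulr_suml sum_deviation // mul0r addr0.
rewrite -[(- _) *+ _]mulr_natr.
have := ler_wpM2l gam4h (card_set_vertex_le R S).
by move: (\sum_a _) => T; lra.
Qed.

(** The excess of [x] is at least the deviation of its part, up to
    [2 * gam ^+ 4 * h].  Summed over [S] this bounds the sum of the squares of
    the deviations, since a part counts as often as it has elements in [S];
    the first powers then follow from the inequality of the means, used with
    the weight [gam ^+ 2 * h]. *)
Lemma sum_abs_deviation : \sum_a `|dev a| <= 2 * gam ^+ 2 * r%:R * h.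
Proof.
have gh : 0 < 4 * gam ^+ 2 * h by rewrite !mulr_gt0 ?exprn_gt0.
apply: le_trans (_ : \sum_a (dev a ^+ 2 / (4 * gam ^+ 2 * h) + gam ^+ 2 * h) <= _).
  apply: ler_sum => a _; rewrite -(ler_pM2r gh).
  have -> : (dev a ^+ 2 / (4 * gam ^+ 2 * h) + gam ^+ 2 * h) * (4 * gam ^+ 2 * h) =
      dev a ^+ 2 + (2 * gam ^+ 2 * h) ^+ 2.
    by field; rewrite h1_neq0 gt_eqF.
  have := sqr_ge0 (`|dev a| - 2 * gam ^+ 2 * h).
  by rewrite sqrrB real_normK ?num_real //; lra.
rewrite big_split /= -mulr_suml sumr_const card_ord.
rewrite -[(_ * h) *+ _]mulr_natr.
have E : (\sum_a dev a ^+ 2) / (4 * gam ^+ 2 * h) <= gam ^+ 2 * r%:R * h.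
  rewrite ler_pdivrMr //; apply: le_trans sum_dev_sqr _.
  by rewrite le_eqVlt; apply/orP; left; apply/eqP; ring.
apply: le_trans (lerD E (lexx _)) _.
by rewrite le_eqVlt; apply/orP; left; apply/eqP; ring.
Qed.

(** A sum that vanishes and whose terms are not very negative has small terms
    on average; Markov's inequality concludes. *)
Lemma few_not_flat : gam * h <= W.+1%:R ->
  #|[set x in S | ~~ flat g W S x]|%:R <= 16 * gam * r%:R * h.
Proof.
move=> Wh; set X := [set x in S | _].
have nonflat x : x \in X -> gam * h <= `|excess x|.
  rewrite inE /flat /flat_degree => /andP[xS]; apply: contraR; rewrite -ltNge => lt.
  have {}lt := lt_le_trans lt Wh; move: lt; rewrite ltr_norml /excess => /andP[].
  rewrite -!natrM -natrD -natr1 => e1 e2.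
  have e1' : #|S|%:R < ((degree_in g S x).*2 + part_size S (part x) + W).+1%:R :> R.
    by rewrite -natr1 !natrD -mul2n; move: e1; rewrite !natrD; lra.
  have e2' : ((degree_in g S x).*2 + part_size S (part x))%:R < (#|S| + W).+1%:R :> R.
    by rewrite -natr1 !natrD -mul2n; move: e2; rewrite !natrD; lra.
  by rewrite ltr_nat ltnS in e1'; rewrite ltr_nat ltnS in e2'; rewrite e1' e2'.
have absx x : x \in S ->
    `|excess x| <= excess x + 2 * (`|dev (part x)| + 2 * gam ^+ 4 * h).
  move=> xS; have := excess_ge xS; have := ler_norm (- dev (part x)); rewrite normrN.
  have : 0 <= `|dev (part x)| by [].
  have := gam4h.
  by case: (ger0P (excess x)); lra.
have tot : \sum_(x in S) `|excess x| <= 16 * gam ^+ 2 * r%:R * h ^+ 2.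
  apply: le_trans (ler_sum _ absx) _.
  rewrite big_split /= sum_excess add0r -mulr_sumr big_split /= sumr_const.
  rewrite (sum_over_parts S (fun a => `|dev a|)) -[(_ * h) *+ _]mulr_natr.
  have : \sum_a `|dev a| *+ part_size S a <= 2 * h * \sum_a `|dev a|.
    rewrite mulr_sumr; apply: ler_sum => a _; rewrite -[_ *+ part_size _ _]mulr_natl.
    by apply: ler_wpM2r.
  have hh : 0 <= 2 * h by rewrite mulr_ge0 // ltW.
  have := ler_wpM2l hh sum_abs_deviation.
  have := ler_wpM2l gam4h (card_set_vertex_le R S).
  have : gam ^+ 4 * (r%:R * h ^+ 2) <= gam ^+ 2 * (r%:R * h ^+ 2).
    apply: ler_wpM2r; first by rewrite mulr_ge0 ?exprn_ge0 // ltW.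
    by rewrite ler_wiXn2l // ltW.
  by move: (\sum_a _) (\sum_a _) => T1 T2; lra.
have gh : 0 < gam * h by rewrite mulr_gt0.
rewrite -(ler_pM2r gh).
apply: le_trans (_ : \sum_(x in X) `|excess x| <= _).
  rewrite mulr_natl -sumr_const.
  by apply: ler_sum => x /nonflat.
apply: le_trans (_ : \sum_(x in S) `|excess x| <= _).
  rewrite [leRHS](bigID (mem X)) /= [X in _ <= X + _](eq_bigl (mem X)); last first.
    by move=> x; rewrite /= /X !inE; case: (x \in S).
  by rewrite lerDl sumr_ge0.
by apply: le_trans tot _; rewrite le_eqVlt; apply/orP; left; apply/eqP; ring.
Qed.
End Spread.

(** * Balanced sets are cut by most pairings *)

(** If the sides of a part contain [e] and [o] elements of [S], the two sides of
    the inequality differ by [(e - o) ^+ 2]. *)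
Lemma cut_slots_lower (R : realFieldType) (r h' : nat) (S : {set vertex r h'}) :
  (h'.+1 <= r)%N ->
  \sum_(b : 'I_r | (h'.+1 <= b)%N)
     (part_size S b)%:R * (2 * h'.+1%:R - (part_size S b)%:R)
  <= 2 * \sum_(a : 'I_r | (a < h'.+1)%N) #|cut_slots S a|%:R :> R.
Proof.
move=> hr; rewrite -natr_sum (sum_cut_slots S hr) natr_sum mulr_sumr.
apply: ler_sum => b _; rewrite -(card_half_parts S b).
have c v := cardsC (half_part S b v).
have cR v : #|half_part S b v|%:R + #|~: half_part S b v|%:R = h'.+1%:R :> R.
  by rewrite -natrD c card_ord.
rewrite !natrD !natrM; have := cR true; have := cR false.
move: #|half_part S b false|%:R #|half_part S b true|%:R #|~: half_part S b false|%:R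
  #|~: half_part S b true|%:R => e o e' o' <- h2.
have -> : o' = e + e' - o by rewrite -h2 addrC addKr.
by rewrite -subr_ge0; have := sqr_ge0 (e - o); rewrite sqrrB; nra.
Qed.

Lemma cut_slots_le (r h' : nat) (S : {set vertex r h'}) (a : 'I_r) :
  (#|cut_slots S a| <= r * h'.+1)%N.
Proof. by apply: leq_trans (max_card _) _; rewrite card_prod !card_ord. Qed.

Lemma cut_parts_bound (R : realFieldType) (gam eta r h x y z rho : R) :
  x <= 16 * gam * r * h -> y + z <= 2 * rho -> r * (gam * h) <= 4 * h * (gam * h) ->
  rho <= eta * h ^+ 2 -> x + (y + z) <= 64 * gam * h ^+ 2 + 2 * (eta * h ^+ 2).
Proof. by move=> h1 h2 h3 h4; lra. Qed.

(** Here [S] has all degrees almost average, in a tournament in which few flat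
    vertices have many cut pairs.  By [few_not_flat] almost all vertices of [S]
    are flat, so few parts in the first [h'.+1] have many cut pairs (the set
    [B]); but the total number of cut pairs is large since the parts of [S]
    have nearly the size [mu]. *)
Section Unbalanced.
Context (R : realFieldType) (r h' W K rho : nat) (g : {ffun slot r h' -> {set slot r h'}}).
Context (S : {set vertex r h'}) (gam nu kap eta : R).
Local Notation N := (#|S|%:R : R).
Local Notation h := (h'.+1%:R : R).
Local Notation mu := (N / r%:R).
Local Notation dev := (deviation R S).
Context (r_ge : (2 * h'.+1 <= r)%N) (r_le : (r <= 4 * h'.+1)%N).
Context (gam01 : 0 < gam <= 1) (nu_gt0 : 0 < nu) (kap0 : 0 <= kap).
Context (Wh : gam * h <= W.+1%:R) (Kh : K%:R <= kap * h ^+ 2) (rhoh : rho%:R <= eta * h ^+ 2).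
Context (good : forall u, (#|[set c : slot r h' |
  [&& (c.1 < h'.+1)%N, (K <= #|cut_slots S c.1|)%N & flat g W S (c, u)]]| < rho)%N).
Context (rich : forall x, x \in S ->
  N * (1 - r%:R^-1) / 2 - gam ^+ 4 * h <= (degree_in g S x)%:R).
Context (mu_ge : 2 * h * nu <= mu) (mu_le : mu <= 2 * h * (1 - nu)).

Let h_gt0 : 0 < h. Proof. by rewrite ltr0n. Qed.
Let r_gt0 : (0 < r)%N. Proof. by apply: leq_trans r_ge. Qed.
Let h_le_r : (h'.+1 <= r)%N. Proof. by apply: leq_trans r_ge; rewrite leq_pmull. Qed.
Let rh : r%:R <= 4 * h. Proof. by rewrite -natrM ler_nat. Qed.
Let gam_gt0 : 0 < gam. Proof. by case/andP: gam01. Qed.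
Let gam_le1 : gam <= 1. Proof. by case/andP: gam01. Qed.
Let abs_dev : \sum_a `|dev a| <= 8 * gam ^+ 2 * h ^+ 2.
Proof.
apply: le_trans (sum_abs_deviation r_gt0 gam01 rich) _.
have : 0 <= gam ^+ 2 * h by rewrite mulr_ge0 ?exprn_ge0 // ltW.
by move=> /ler_wpM2r/(_ _ _ rh); lra.
Qed.

Let B := [set a : 'I_r | (a < h'.+1)%N && (K <= #|cut_slots S a|)%N].

Let sum_cut_parts : \sum_(a in B) (part_size S a)%:R <= 64 * gam * h ^+ 2 + 2 * (eta * h ^+ 2).
Proof.
pose G u := [set c : slot r h' | [&& (c.1 < h'.+1)%N, (K <= #|cut_slots S c.1|)%N
  & flat g W S (c, u)]].
pose X := [set x in S | ~~ flat g W S x].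
have e1 : (\sum_(a in B) part_size S a = #|[set x in S | part x \in B]|)%N.
  rewrite -sum1_card (partition_big (fun x : vertex r h' => part x) (mem B)) /=; last first.
    by move=> x; rewrite in_set => /andP[].
  apply: eq_bigr => a aB; rewrite /part_size -sum1_card; apply: eq_bigl => x.
  rewrite [LHS]in_set [X in _ = X && _]in_set; case: (x \in S) => //=.
  by case: eqP => [->|]; rewrite ?andbF // aB.
have e2 : (#|[set x in S | part x \in B]| <= #|X| + (#|G true| + #|G false|))%N.
  have im u : (#|(fun c => (c, u) : vertex r h') @: G u| <= #|G u|)%N by apply: leq_imset_card.
  apply: leq_trans (leq_add (leqnn _) (leq_add (im true) (im false))).
  apply: leq_trans (leq_add (leqnn _) (leq_card_setU _ _)).
  apply: leq_trans (leq_card_setU _ _); apply: subset_leq_card.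
  apply/subsetP => -[c u]; rewrite in_set => /andP[xS]; rewrite in_set => /andP[ch cK].
  rewrite 2!in_setU [_ \in X]in_set xS /=; case: (boolP (flat g W S (c, u))) => //= fl.
  have inG (v : bool) : c \in G v -> ((c, v) \in (fun c => (c, true) : vertex r h') @: G true)
      || ((c, v) \in (fun c => (c, false) : vertex r h') @: G false).
    by case: v => cG; rewrite imset_f ?orbT.
  by apply: inG; rewrite in_set ch cK fl.
have e3 := few_not_flat r_gt0 gam01 rich Wh; rewrite -/X in e3.
have e4 : #|G true|%:R + #|G false|%:R <= 2 * rho%:R :> R.
  by rewrite -natrD -natrM ler_nat mul2n -addnn leq_add // ltnW // good.
rewrite -natr_sum e1; apply: le_trans (_ : (#|X| + (#|G true| + #|G false|))%:R <= _).
  by rewrite ler_nat.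
rewrite 2!natrD.
have : 0 <= gam * h by rewrite mulr_ge0 // ltW.
move=> /ler_wpM2r/(_ _ _ rh) e5.
exact: cut_parts_bound e3 e4 e5 rhoh.
Qed.

Let card_B : #|B|%:R * (2 * nu) <= (72 * gam + 2 * eta) * h.
Proof.
have b1 : #|B|%:R * mu <= \sum_(a in B) ((part_size S a)%:R + `|dev a|).
  rewrite mulr_natl -sumr_const; apply: ler_sum => a _.
  by have := ler_norm (- dev a); rewrite normrN {1}/deviation; lra.
have b2 : \sum_(a in B) `|dev a| <= \sum_a `|dev a|.
  by rewrite [leRHS](bigID (mem B)) /= lerDl sumr_ge0.
have b3 : #|B|%:R * (2 * h * nu) <= #|B|%:R * mu by rewrite ler_wpM2l.
have b4 : gam ^+ 2 * h ^+ 2 <= gam * h ^+ 2.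
  by rewrite ler_wpM2r ?exprn_ge0 ?(ltW h_gt0) // expr2 ler_piMl // ltW.
rewrite big_split /= in b1.
rewrite -(ler_pM2r h_gt0); have := sum_cut_parts; have := abs_dev.
by move: b1 b2 b3 b4; move: (\sum_(a in B) _) (\sum_a _) (\sum_(a in B) _) => T1 T2 T3; lra.
Qed.

Let sum_cut_le : \sum_(a : 'I_r | (a < h'.+1)%N) #|cut_slots S a|%:R
  <= kap * h ^+ 3 + 4 * h ^+ 2 * #|B|%:R.
Proof.
rewrite (bigID (mem B)) /= addrC; apply: lerD.
  apply: le_trans (_ : \sum_(a : 'I_r | (a < h'.+1)%N) kap * h ^+ 2 <= _).
    rewrite [leRHS](bigID (mem B)) /= -[leLHS]add0r; apply: lerD.
      by apply: sumr_ge0 => a _; rewrite mulr_ge0 ?exprn_ge0 ?(ltW h_gt0).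
    apply: ler_sum => a /andP[ah]; rewrite inE ah /= -ltnNge => cK.
    by apply: le_trans Kh; rewrite ler_nat ltnW.
  rewrite (big_ord_narrow h_le_r) /= sumr_const card_ord -[_ *+ _]mulr_natr.
  by rewrite le_eqVlt; apply/orP; left; apply/eqP; ring.
rewrite (eq_bigl (mem B)); last first.
  by move=> a; rewrite /= inE; case: (a < _)%N.
apply: le_trans (_ : \sum_(a in B) 4 * h ^+ 2 <= _).
  apply: ler_sum => a _; apply: le_trans (_ : (r * h'.+1)%:R <= _).
    by rewrite ler_nat cut_slots_le.
  by rewrite natrM expr2 mulrA ler_pM2r.
by rewrite sumr_const mulr_natr.
Qed.

Let sum_cut_ge : 4 * nu ^+ 2 * h ^+ 3 - 16 * gam ^+ 2 * h ^+ 3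
  <= 2 * \sum_(a : 'I_r | (a < h'.+1)%N) #|cut_slots S a|%:R.
Proof.
apply: le_trans (cut_slots_lower R S h_le_r).
pose P := fun b : 'I_r => (h'.+1 <= b)%N.
apply: le_trans (_ : \sum_(b : 'I_r | P b) (4 * nu ^+ 2 * h ^+ 2 - 2 * h * `|dev b|) <= _); last first.
  apply: ler_sum => b _.
  have q2 : (part_size S b)%:R <= 2 * h by rewrite -natrM ler_nat part_size_le.
  have q0 : 0 <= (part_size S b)%:R :> R by [].
  have qE : (part_size S b)%:R = mu + dev b by rewrite /deviation addrC subrK.
  move: q0 q2; rewrite qE; move: mu_ge mu_le; move: mu (dev b) => m d m1 m2 q0 q2.
  have p1 : 4 * nu ^+ 2 * h ^+ 2 <= m * (2 * h - m).
    have -> : 4 * nu ^+ 2 * h ^+ 2 = (2 * h * nu) * (2 * h * nu) by ring.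
    have hn : 0 <= 2 * h * nu by rewrite !mulr_ge0 // ltW.
    apply: ler_pM => //; lra.
  have p2 : - (2 * h * `|d|) <= d * (2 * h - 2 * m - d).
    rewrite lerNl; apply: le_trans (ler_norm _) _; rewrite normrN normrM mulrC.
    apply: ler_wpM2r => //; rewrite ler_norml.
    have hn : 0 <= h * nu by rewrite mulr_ge0 // ltW.
    by apply/andP; split; lra.
  by lra.
rewrite big_split /= sumrN -[X in _ <= _ - X]mulr_sumr.
have d1 : \sum_(b : 'I_r | P b) `|dev b| <= 8 * gam ^+ 2 * h ^+ 2.
  by apply: le_trans abs_dev; rewrite [leRHS](bigID P) /= lerDl sumr_ge0.
have c1 : h * (4 * nu ^+ 2 * h ^+ 2) <= \sum_(b : 'I_r | P b) 4 * nu ^+ 2 * h ^+ 2.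
  rewrite sumr_const -[_ *+ #|_|]mulr_natl ler_wpM2r ?mulr_ge0 ?exprn_ge0 ?(ltW h_gt0) ?(ltW nu_gt0) //.
  rewrite ler_nat.
  have := cardC P; rewrite card_ord => cP.
  have cQ : (#|[predC P]| <= h'.+1)%N.
    rewrite -sum1_card (eq_bigl (fun b : 'I_r => (b < h'.+1)%N)).
      by rewrite (big_ord_narrow h_le_r) sum1_card card_ord.
    by move=> b; rewrite /P inE /= -ltnNge.
  have hP : (h'.+1 <= #|P|)%N.
    rewrite -(leq_add2r #|[predC P]|) cP; apply: leq_trans r_ge.
    by rewrite mul2n -addnn leq_add2l.
  by apply: leq_trans hP _; rewrite subset_leq_card //; apply/subsetP.
have h0 : 0 <= 2 * h by rewrite mulr_ge0 // ltW.
have := ler_wpM2l h0 d1; move: c1.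
by move: (\sum_(b | P b) _) (\sum_(b | P b) _) => T1 T2; lra.
Qed.

(** The upper and the lower estimate of the total number of cut pairs compared,
    after division by [h ^+ 3]. *)
Lemma unbalanced_constants :
  4 * nu ^+ 2 <= 2 * kap + (288 * gam + 8 * eta) / nu + 16 * gam ^+ 2.
Proof.
have h3 : 0 < h ^+ 3 by rewrite exprn_gt0.
have c1 : 8 * h ^+ 2 * #|B|%:R <= (288 * gam + 8 * eta) / nu * h ^+ 3.
  have hn : 0 <= 4 * h ^+ 2 / nu by rewrite divr_ge0 ?mulr_ge0 ?exprn_ge0 // ltW.
  have := ler_wpM2l hn card_B.
  have -> : 4 * h ^+ 2 / nu * (#|B|%:R * (2 * nu)) = 8 * h ^+ 2 * #|B|%:R.
    by field; rewrite gt_eqF.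
  by move=> /le_trans; apply; rewrite le_eqVlt; apply/orP; left; apply/eqP; field; rewrite gt_eqF.
rewrite -(ler_pM2r h3); have := sum_cut_ge; have := sum_cut_le.
by move: (\sum_(a | _) _) => T; lra.
Qed.
End Unbalanced.

(** * Every proportional set has a vertex of small degree *)

Lemma constants_contradiction (R : realFieldType) (nu gam : R) :
  0 < nu <= 2^-1 -> 0 < gam -> 400 * gam <= nu ^+ 3 ->
  2 * (nu ^+ 2 / 2) + (288 * gam + 8 * (nu ^+ 3 / 8)) / nu + 16 * gam ^+ 2 < 4 * nu ^+ 2.
Proof.
move=> /andP[nu0 nu1] g0 g1.
have n2 : 0 < nu ^+ 2 by rewrite exprn_gt0.
have gn : gam <= nu ^+ 2 / 400 * nu by move: g1; rewrite exprSr; lra.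
have d1 : (288 * gam + 8 * (nu ^+ 3 / 8)) / nu <= 2 * nu ^+ 2.
  rewrite ler_pdivrMr //; move: gn; rewrite exprSr.
  by have := mulr_gt0 n2 nu0; lra.
have g2 : gam <= nu / 4.
  have : nu ^+ 2 * nu <= nu by rewrite ler_piMl ?expr_le1 //; lra.
  by move: gn; lra.
have e : gam ^+ 2 <= nu / 4 * (nu ^+ 2 / 400 * nu) by rewrite expr2 ler_pM // ltW.
have : nu * nu <= 4^-1 by nra.
move: d1 e n2; rewrite !expr2; move: (_ / nu) => T; nra.
Qed.

(** The constants are chosen in the order [eta], [e], [gam], which allows the
    small ball probability [2 ^ - e] to beat the number of sets although it
    enters with the exponent [rho], a small multiple of [h ^ 2]; then
    [c = gam ^+ 4]. *)
Lemma exists_unbalanced_tournament (R : realType) (nu : R) : 0 < nu <= 2^-1 ->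
  exists c : R, 0 < c /\ exists h0 : nat, forall h' r : nat,
    (h0 <= h')%N -> (2 * h'.+1 <= r)%N -> (r <= 4 * h'.+1)%N ->
    exists g : {ffun slot r h' -> {set slot r h'}}, forall S : {set vertex r h'},
      2 * h'.+1%:R * nu <= #|S|%:R / r%:R -> #|S|%:R / r%:R <= 2 * h'.+1%:R * (1 - nu) ->
      exists2 x, x \in S &
        (degree_in g S x)%:R < #|S|%:R * (1 - r%:R^-1) / 2 - c * h'.+1%:R.
Proof.
move=> nu01; have /andP[nu0 nu1] := nu01.
(* [eta] bounds the proportion of exceptional rows, and [26 <= e * eta]
   makes [e * rho] exceed the number of bits of a set of vertices and a
   set of rows. *)
pose eta := nu ^+ 3 / 8; have eta0 : 0 < eta by rewrite divr_gt0 ?exprn_gt0.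
pose e := (Num.truncn (26 / eta)).+1.
have e_ge : 26 <= e%:R * eta by rewrite -ler_pdivrMr //; apply/ltW/truncnS_gt.
pose gam := nu ^+ 3 / (400 * 2 ^+ e).
have p2 : 1 <= 2 ^+ e :> R by rewrite exprn_ege1 // ler1n.
have gam0 : 0 < gam by rewrite divr_gt0 ?exprn_gt0 // mulr_gt0 ?exprn_gt0.
have gE : 400 * 2 ^+ e * gam = nu ^+ 3.
  by rewrite /gam mulrC divfK // mulf_neq0 ?expf_neq0 ?pnatr_eq0.
have n3 : nu ^+ 3 <= 1 by rewrite exprn_ile1 //; lra.
have g400 : 400 * gam <= nu ^+ 3 by rewrite -gE -!mulrA ler_wpM2l // ler_peMl // ltW.
have gam1 : gam <= 1 by lra.
have gam01 : 0 < gam <= 1 by rewrite gam0.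
clearbody gam.
exists (gam ^+ 4); split; first by rewrite exprn_gt0.
exists (Num.truncn (gam^-1)) => h' r hh r1 r2.
set h : R := h'.+1%:R.
have h_pos : 0 < h by rewrite ltr0n.
have gh : 1 <= gam * h.
  rewrite -ler_pdivrMl // mulr1; apply: ltW; apply: lt_le_trans (truncnS_gt _) _.
  by rewrite ler_nat ltnS.
pose W := Num.truncn (gam * h); pose K := Num.truncn (nu ^+ 2 / 2 * h ^+ 2).
pose rho := Num.truncn (eta * h ^+ 2).
have n2 : 0 < nu ^+ 2 by rewrite exprn_gt0.
have h2 : 0 < h ^+ 2 by rewrite exprn_gt0.
have Wle : W%:R <= gam * h by rewrite truncn_le mulr_ge0 // ltW.
have Wge : gam * h <= W.+1%:R by apply/ltW/truncnS_gt.
have Kle : K%:R <= nu ^+ 2 / 2 * h ^+ 2.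
  by rewrite truncn_le !mulr_ge0 ?invr_ge0 // ltW.
have rhole : rho%:R <= eta * h ^+ 2 by rewrite truncn_le mulr_ge0 // ltW.
have rhoge : eta * h ^+ 2 < rho%:R + 1 by rewrite natr1; apply: truncnS_gt.
have WK : (W.+1 ^ 2 * 4 ^ e <= K)%N.
  have k0 : 0 <= nu ^+ 2 / 2 * h ^+ 2 by rewrite mulr_ge0 ?divr_ge0 ?(ltW n2) ?(ltW h2).
  rewrite /K truncn_ge_nat //.
  rewrite natrM !natrX.
  have -> : 4 ^+ e = (2 ^+ e) ^+ 2 :> R by rewrite exprAC; congr (_ ^+ _); ring.
  have w2 : W.+1%:R <= 2 * (gam * h) by rewrite -natr1; lra.
  rewrite -exprMn; apply: le_trans (_ : (2 * (gam * h) * 2 ^+ e) ^+ 2 <= _).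
    rewrite ler_pXn2r ?nnegrE ?mulr_ge0 ?exprn_ge0 ?(ltW gam0) ?(ltW h_pos) //.
    by rewrite ler_wpM2r // exprn_ge0.
  have -> : 2 * (gam * h) * 2 ^+ e = nu ^+ 3 / 200 * h by rewrite -gE; field.
  rewrite exprMn ler_wpM2r ?(ltW h2) //.
  have : nu ^+ 3 <= nu ^+ 2 by rewrite exprS ler_piMl ?(ltW n2) //; lra.
  have n30 : 0 < nu ^+ 3 by rewrite exprn_gt0.
  by move: n30 n3 n2; move: (nu ^+ 3) (nu ^+ 2) => a b; nra.
have h400 : 400 <= h.
  have : 400 * (gam * h) <= h by rewrite mulrA ler_piMl ?(ltW h_pos) //; lra.
  by lra.
have etah : 2 <= eta * h ^+ 2.
  have : 1 <= nu ^+ 3 / 400 * h.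
    apply: le_trans gh _; rewrite ler_wpM2r ?(ltW h_pos) //; lra.
  rewrite /eta expr2; move: (nu ^+ 3) h400 => a; nra.
have er : (3 * (r * h'.+1) + 1 < e * rho)%N.
  rewrite -(ltr_nat R) natrD !natrM.
  have rh : r%:R <= 4 * h by rewrite -natrM ler_nat.
  have h1 : 1 < h ^+ 2.
    by rewrite exprn_egt1 //; lra.
  have s1 : 13 * h ^+ 2 <= e%:R * rho%:R.
    apply: le_trans (_ : e%:R * (eta * h ^+ 2 / 2) <= _); last first.
      by rewrite ler_wpM2l //; lra.
    by have := ler_wpM2r (ltW h2) e_ge; lra.
  have := ler_wpM2r (ltW h_pos) rh; rewrite -/h.
  by move: s1 h1; rewrite expr2; move: (e%:R * rho%:R) => T; lra.
have [g hg] := exists_good_tournament WK er.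
exists g => S mu1 mu2; have [/exists_inP[x xS hx]|no] := boolP [exists x in S,
   (degree_in g S x)%:R < #|S|%:R * (1 - r%:R^-1) / 2 - gam ^+ 4 * h].
  by exists x.
have rich x : x \in S -> #|S|%:R * (1 - r%:R^-1) / 2 - gam ^+ 4 * h <= (degree_in g S x)%:R.
  move=> xS; rewrite leNgt; apply: contra no => lt.
  by apply/exists_inP; exists x.
have kap0 : 0 <= nu ^+ 2 / 2 by rewrite divr_ge0 ?(ltW n2).
have := unbalanced_constants r1 r2 gam01 nu0 kap0 Wge Kle rhole (hg S) rich mu1 mu2.
by rewrite leNgt constants_contradiction.
Qed.

(** * Hitting prescribed degrees and sizes *)

(** Put [m = ceil (sqrt (s / 2))] and let [j ^ 2] be the largest square up to
    [m ^ 2 - s / 2]; then [h = m - j] and [k = m + j] have a product close to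
    [s / 2].  Two consecutive squares around [m ^ 2 - s / 2], a number of order
    [sqrt s], differ by only [O(s ^ (1 / 4))], whereas changing one factor
    alone would move the product in steps of order [sqrt s], as large as the
    effect to be proved. *)
Lemma near_square_product (s : nat) : (900 <= s)%N ->
  exists h k j : nat, [/\ (s <= 2 * k * h <= s + 1 + 4 * j)%N, (h <= k)%N,
    (2 * k + 1 <= 4 * h)%N, (j ^ 2 <= 4 * h)%N & (s <= 8 * h ^ 2)%N].
Proof.
move=> s900; pose s' := uphalf s.
have ex1 : exists i, (s' <= i ^ 2)%N by exists s'; nia.
case: (ex_minnP ex1) => m m1 m2.
have m0 : (0 < m)%N by case: (m) m1 => //; rewrite /s'; lia.
have m3 : (m.-1 ^ 2 < s')%N.
  by rewrite ltnNge; apply/negP => /m2; rewrite leqNgt prednK // leqnn.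
have ex2 : exists i, (i ^ 2 <= m ^ 2 - s')%N by exists 0%N.
have bd i : (i ^ 2 <= m ^ 2 - s')%N -> (i <= m ^ 2)%N by nia.
case: (ex_maxnP ex2 bd) => j j1 j2.
have j3 : (m ^ 2 - s' < j.+1 ^ 2)%N.
  by rewrite ltnNge; apply/negP => /j2; rewrite ltnn.
have m20 : (21 <= m)%N by rewrite /s' in m1; nia.
have jm : (j ^ 2 <= 2 * m)%N by apply: leq_trans j1 _; nia.
have j6 : (3 * j + 1 <= m)%N.
  rewrite leqNgt; apply/negP => h.
  have : (m * m <= 9 * (j * j) )%N by nia.
  nia.
exists (m - j)%N, (m + j)%N, j.
have prodE : (2 * (m + j) * (m - j) = 2 * (m ^ 2 - j ^ 2))%N.
  by rewrite subn_sqr; nia.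
have mj : (3 * (m - j) >= 2 * m)%N by lia.
have s2 : (s <= 2 * s' <= s + 1)%N by rewrite /s'; lia.
split.
- by rewrite prodE; nia.
- lia.
- lia.
- nia.
- nia.
Qed.

Definition padded_arc (T : finType) (l : nat) (e : rel T) : rel (T + 'I_l) :=
  fun x y => match x, y with
  | inl x, inl y => e x y
  | inr _, inl _ => true
  | _, inr _ => false
  end.

(** Vertices without in-neighbours that point to the whole regular digraph
    adjust the number of vertices and contribute nothing to the degrees inside
    a subdigraph. *)
Lemma guaranteed_regular (R : realType) (alpha : R) (T : finType) (e : rel T)
    (s D d n l : nat) :
  irreflexive e -> (forall x, #|[set y | e x y]| = D) -> (s <= D <= #|T|)%N ->
  (0 < n)%N -> (#|T| + l)%N%:Z = Num.floor (alpha * n%:R) ->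
  guaranteed alpha s d ->
  exists S : {set T}, (#|S| <= n <= #|S| + l)%N /\
    forall x, x \in S -> (d <= #|[set y in S | e x y]|)%N.
Proof.
move=> ei eD /andP[sD DT] n0 nE gd.
pose e' := @padded_arc T l e.
have ev (x y : T + 'I_l) : e' x y -> (x \in [set: T + 'I_l]) && (y \in [set: T + 'I_l]).
  by rewrite !inE.
have ei' : irreflexive e' by case=> [x|i] //=; apply: ei.
pose G := Digraph ev ei'.
have cG : #|vertices G| = (#|T| + l)%N by rewrite cardsT card_sum card_ord.
have [|H [[_ HG] Hn dH]] := gd n n0 _ G (etrans (congr1 Posz cG) nE).
  apply: min_outdeg_leP => [|x _].
    by rewrite cG (leq_trans sD) // (leq_trans DT) // leq_addr.
  have inj : injective (@inl T 'I_l) by move=> ? ? [].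
  apply: leq_trans sD _; case: x => [x|i]; rewrite /outdeg.
    rewrite -(eD x) -(card_imset _ inj); apply: subset_leq_card.
    by apply/subsetP => _ /imsetP[y + ->]; rewrite !inE.
  apply: leq_trans DT _; rewrite -cardsT -(card_imset _ inj); apply: subset_leq_card.
  by apply/subsetP => _ /imsetP[y _ ->]; rewrite !inE.
have inj : injective (@inl T 'I_l) by move=> ? ? [].
pose S := [set x : T | inl x \in vertices H]; exists S; split.
  rewrite -Hn; apply/andP; split.
    rewrite -(card_imset _ inj); apply: subset_leq_card.
    by apply/subsetP => _ /imsetP[y + ->]; rewrite inE.
  apply: leq_trans (_ : #|(@inl T 'I_l) @: S :|: (@inr T 'I_l) @: setT| <= _)%N.
    apply: subset_leq_card; apply/subsetP => -[x|i] xH; rewrite inE.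
      by rewrite imset_f // inE.
    by rewrite orbC imset_f.
  apply: leq_trans (leq_card_setU _ _) _; apply: leq_add; first exact: leq_imset_card.
  by apply: leq_trans (leq_imset_card _ _) _; rewrite cardsT card_ord.
move=> x; rewrite inE => xH; apply: leq_trans dH _.
apply: leq_trans (min_outdeg_le xH) _; rewrite -(card_imset _ inj) /outdeg.
apply: subset_leq_card; apply/subsetP => y; rewrite inE => xy.
have /andP[_ yH] := arc_vertices xy; have := HG _ _ xy.
case: y xy yH => [y|i] //= xy yH exy.
by apply: imset_f; rewrite !inE yH.
Qed.

Lemma quarter_bound (R : realFieldType) (c h j : R) :
  0 <= c -> 0 <= h -> 0 <= j -> j ^+ 2 <= 4 * h -> 1024 <= c ^+ 2 * h -> 4 * j <= c * h / 4.
Proof.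
move=> c0 h0 j0 jh hc; have ch0 : 0 <= c * h by apply: mulr_ge0.
rewrite -[_ <= _](@ler_pXn2r _ 2) ?nnegrE ?mulr_ge0 ?invr_ge0 //.
have -> : (c * h / 4) ^+ 2 = c ^+ 2 * h * h / 16 by field.
have -> : (4 * j) ^+ 2 = 16 * j ^+ 2 by ring.
by have := ler_wpM2r h0 hc; lra.
Qed.

(** The gain [c * h] exceeds the two losses, [4 * j] from the approximation of
    [s] and a constant from rounding, by a factor 2. *)
Lemma final_bound (R : realFieldType) (a c h j s d q Q : R) :
  0 < a -> a < 1 -> 0 < c -> 0 <= j -> d < Q - c * h ->
  Q <= a * (s + 1 + 4 * j) + 2^-1 -> 4 * j <= c * h / 4 -> 6 <= c * h -> q <= 3 * h ->
  c / 6 * q <= s * a - d.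
Proof.
move=> a0 a1 c0 j0 dQ Qs jh ch qh.
have := ler_wpM2l (ltW c0) qh.
have := ler_wpM2r j0 (ltW a1).
lra.
Qed.

Lemma dmax_upper_bound (R : realType) (alpha : R) : 1 < alpha ->
  exists c : R, 0 < c /\ exists s0 : nat, forall s : nat, (s0 <= s)%N ->
    c * Num.sqrt s%:R <= s%:R / alpha - (dmax alpha s)%:R.
Proof.
move=> a1; pose a := alpha^-1.
have alpha0 : 0 < alpha by lra.
have a0 : 0 < a by rewrite invr_gt0.
have a_lt1 : a < 1 by rewrite invf_lt1.
have aK : a * alpha = 1 by rewrite mulVf // gt_eqF.
pose nu := Num.min a (1 - a) / 2.
have nuE : 2 * nu = Num.min a (1 - a) by rewrite /nu; field.
have nua : 2 * nu <= a by rewrite nuE ge_min lexx.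
have nub : 2 * nu <= 1 - a by rewrite nuE ge_min lexx orbT.
have nu0 : 0 < nu by rewrite divr_gt0 // lt_min a0 subr_gt0.
clearbody nu; clear nuE.
have nu01 : 0 < nu <= 2^-1 by rewrite nu0; lra.
have [c [c0 [h0 hc]]] := exists_unbalanced_tournament nu01.
(* One summand for each of the four ways in which [h] has to be large. *)
pose B : R := 1024 / c ^+ 2 + 6 / c + alpha / a + (1 - a)^-1.
pose H := (h0 + (Num.truncn B).+1)%N.
exists (c / 6); split; first by rewrite divr_gt0.
exists (900 + 8 * H ^ 2)%N => s sH.
have s900 : (900 <= s)%N by apply: leq_trans sH; rewrite leq_addr.
have [h [k [j [sP hk kh jh hs]]]] := near_square_product s900.
have Hh : (H < h)%N.
  rewrite ltnNge; apply/negP => hH.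
  have : (8 * h ^ 2 <= 8 * H ^ 2)%N by rewrite leq_mul2l leq_exp2r.
  move=> /(leq_trans hs)/(leq_trans sH); by rewrite leqNgt -[X in (X < _)%N]add0n ltn_add2r.
have BH : B <= h%:R.
  apply/ltW/(lt_le_trans (truncnS_gt _)); rewrite ler_nat.
  by apply: leq_trans (ltnW Hh); rewrite leq_addl.
have h0h : (h0 < h)%N by apply: leq_ltn_trans Hh; rewrite leq_addr.
clearbody H; clear H sH Hh.
case: h h0h BH sP hk kh jh hs => // h'; rewrite ltnS => h0h BH sP hk kh jh hs.
set h : R := h'.+1%:R in BH.
have h_pos : 0 < h by rewrite ltr0n.
have B1 : 0 < 1024 / c ^+ 2 by rewrite divr_gt0 // exprn_gt0.
have B2 : 0 < 6 / c by rewrite divr_gt0.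
have B3 : 0 < alpha / a by rewrite divr_gt0.
have B4 : 0 < (1 - a)^-1 by rewrite invr_gt0 subr_gt0.
have hB1 : 1024 <= c ^+ 2 * h.
  by rewrite -ler_pdivrMl ?exprn_gt0 // mulrC; move: BH; rewrite /B; lra.
have hB2 : 6 <= c * h by rewrite -ler_pdivrMl // mulrC; move: BH; rewrite /B; lra.
have hB3 : alpha <= a * h by rewrite -ler_pdivrMl // mulrC; move: BH; rewrite /B; lra.
have hB4 : 1 <= (1 - a) * h.
  by rewrite -ler_pdivrMl ?subr_gt0 // mulr1; move: BH; rewrite /B; lra.
clear BH B1 B2 B3 B4; clearbody B.
pose r := (2 * k).+1.
have r1 : (2 * h'.+1 <= r)%N by rewrite leqW // leq_mul2l.
have r2 : (r <= 4 * h'.+1)%N by rewrite /r -addn1.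
have [g hg] := hc h' r h0h r1 r2.
pose m := #|{: vertex r h'}|.
have mE : m = (2 * r * h'.+1)%N by apply: card_vertex.
have mR : m%:R = 2 * r%:R * h by rewrite mE !natrM.
(* The least integer above [m / alpha], so that [alpha * n] exceeds [m]
   by at most [alpha]; [l] is the number of vertices to add. *)
pose n := (Num.truncn (a * m%:R)).+1.
have n1 : a * m%:R < n%:R by apply: truncnS_gt.
have n2 : n%:R <= a * m%:R + 1.
  by rewrite -natr1 lerD2r truncn_le mulr_ge0 // ltW.
have an0 : 0 <= alpha * n%:R by rewrite mulr_ge0 // ltW.
have mn : m%:R <= alpha * n%:R.
  by rewrite -ler_pdivrMl //; apply: ltW.
pose l := (Num.truncn (alpha * n%:R) - m)%N.
have ml : (m + l = Num.truncn (alpha * n%:R))%N.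
  by rewrite subnKC // truncn_ge_nat.
have lR : l%:R <= alpha.
  have : (m + l)%:R <= alpha * n%:R by rewrite ml truncn_le.
  have : alpha * n%:R <= m%:R + alpha.
    apply: le_trans (ler_wpM2l (ltW alpha0) n2) _.
    by rewrite mulrDr mulrA [alpha * a]mulrC aK mul1r mulr1.
  by rewrite natrD; lra.
have mfloor : (m + l)%N%:Z = Num.floor (alpha * n%:R).
  by rewrite ml truncn_floor an0 gez0_abs // floor_ge0.
have sD : (s <= r.-1 * h'.+1 <= m)%N.
  have /andP[-> _] := sP; rewrite mE leq_mul2r /r /=.
  by apply: leq_trans (leqnSn _) _; rewrite leq_pmull.
have [S [Sn hS]] := guaranteed_regular (@tarc_irrefl r h' g) (tarc_regular g) sD
  (ltn0Sn _) mfloor (proj1 (dmaxP s a1)).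
set N : R := #|S|%:R.
have /andP[N1 N2] : N <= n%:R <= N + l%:R by rewrite /N -natrD !ler_nat.
have r_pos : 0 < r%:R :> R by rewrite ltr0n.
have r_ge1 : 1 <= r%:R :> R by rewrite ler1n.
have N_le : N <= 2 * (a * h * r%:R) + 1.
  by apply: le_trans N1 (le_trans n2 _); rewrite mR lerD2r le_eqVlt; apply/orP; left; apply/eqP; ring.
have N_ge : 2 * (a * h * r%:R) - alpha <= N.
  have : a * m%:R = 2 * (a * h * r%:R) by rewrite mR; ring.
  by move: n1 N2 lR; lra.
have hr_pos : 0 < h * r%:R by rewrite mulr_gt0.
have mu1 : 2 * h * nu <= N / r%:R.
  rewrite ler_pdivlMr //; apply: le_trans N_ge.
  have := ler_wpM2r (ltW hr_pos) nua.
  have : a * h <= a * h * r%:R by rewrite ler_peMr // mulr_ge0 // ltW.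
  by move: hB3; lra.
have mu2 : N / r%:R <= 2 * h * (1 - nu).
  rewrite ler_pdivrMr //; apply: le_trans N_le _.
  have := ler_wpM2r (ltW hr_pos) nub.
  have : (1 - a) * h <= (1 - a) * h * r%:R.
    by rewrite ler_peMr // mulr_ge0 ?(ltW h_pos) // subr_ge0 ltW.
  by move: hB4; lra.
have [x xS degx] := hg S mu1 mu2.
have dx : (dmax alpha s)%:R <= (degree_in g S x)%:R :> R by rewrite ler_nat; apply: (hS x xS).
have {}degx := le_lt_trans dx degx.
have halfN : N * (1 - r%:R^-1) / 2 <= a * (s%:R + 1 + 4 * j%:R) + 2^-1.
  have rV0 : 0 <= 1 - r%:R^-1 :> R by rewrite subr_ge0 invf_le1.
  have rV1 : 1 - r%:R^-1 <= 1 :> R by rewrite gerBl invr_ge0 ltW.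
  apply: le_trans (_ : (2 * (a * h * r%:R) + 1) * (1 - r%:R^-1) / 2 <= _).
    by rewrite ler_pM2r ?invr_gt0 // ler_wpM2r.
  have expand (u v z : R) : z != 0 ->
      (2 * (u * v * z) + 1) * (1 - z^-1) / 2 = u * (v * (z - 1)) + (1 - z^-1) / 2.
    by move=> z0; field.
  rewrite expand ?(gt_eqF r_pos) //.
  apply: lerD; last by rewrite -[leRHS]mul1r ler_pM2r ?invr_gt0.
  have -> : h * (r%:R - 1) = (2 * k * h'.+1)%N%:R.
    by rewrite /r -[(2 * k)%N.+1%:R]natr1 addrK [RHS]natrM mulrC.
  by rewrite ler_pM2l //; case/andP: sP => _; rewrite -(ler_nat R) 2!natrD [X in _ <= _ + X -> _]natrM.
have jc : 4 * j%:R <= c * h / 4.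
  by apply: quarter_bound hB1 => //; [apply: ltW | rewrite -natrX -natrM ler_nat].
have sq : Num.sqrt s%:R <= 3 * h.
  have h3 : 0 <= 3 * h by rewrite mulr_ge0 // ltW.
  rewrite -[leRHS]ger0_norm // -sqrtr_sqr ler_wsqrtr //.
  apply: le_trans (_ : (8 * h'.+1 ^ 2)%:R <= _); first by rewrite ler_nat.
  by rewrite natrM natrX -/h exprMn ler_wpM2r ?sqr_ge0 // -natrX ler_nat.
have j0 : 0 <= j%:R :> R by [].
exact: final_bound a0 a_lt1 c0 j0 degx halfN jc hB2 sq.
Qed.

Theorem corollary1p6 (R : realType) (alpha : R) (halpha : 1 < alpha) :
  exists (c C : R) (s0 : nat),
    [/\ 0 < c, 0 < C &
      forall s : nat, (s0 <= s)%N ->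
        c * Num.sqrt s%:R <= s%:R / alpha - (dmax alpha s)%:R
          <= C * Num.sqrt (s%:R * ln s%:R)].
Proof.
have [c [c0 [s1 up]]] := dmax_upper_bound halpha.
have [s2 low] := dmax_lower_bound halpha.
exists c, 16, (maxn s1 s2); split=> // s; rewrite geq_max => /andP[hs1 hs2].
by rewrite up // low.
Qed.
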